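(* Let $H=H(\mathbf{g},\mathbf{\chi},\mathbf{\lambda})$ be a lifting of a Quantum Linear Space over a field $\mathbf{k}$ (as defined in the context), let $\rho$ be its Nakayama automorphism with respect to a nonzero right integral of $H^*$, let $\alpha\in H^*$ be its modular element, let $L_1=\langle q_{11},\ldots,q_{nn},\alpha(G)\rangle\subseteq\mathbf{k}^*$, and for $\omega\in L_1$ let $H_\omega=\{h\in H:\rho(h)=\omega h\}$. Then the components of the decomposition $H=\bigoplus_{\omega\in L_1}H_\omega$ are equidimensional, i.e. $\dim_{\mathbf{k}}H_\omega=\dim_{\mathbf{k}}H_{\omega'}$ for all $\omega,\omega'\in L_1$.
   Context: Lifting of a Quantum Linear Space: $\mathbf{k}$ is a field, $G$ is a finite abelian group, $g_1,\ldots,g_n\in G$, and $\chi_1,\ldots,\chi_n\in\hat G$ are characters $G\to\mathbf{k}^*$ such that $\chi_i(g_i)\neq 1$ for all $i$ and $\chi_i(g_j)\chi_j(g_i)=1$ for $i\neq j$. Put $q_{ij}=\chi_j(g_i)$ and let $m_i$ be the multiplicative order of $q_{ii}$. Let $\lambda_i\in\mathbf{k}$ and, for $i\ne j$, $\lambda_{ij}\in\mathbf{k}$ be scalars such that $\lambda_i(\chi_i^{m_i}-\varepsilon)=0$ and $\lambda_{ij}(\chi_i\chi_j-\varepsilon)=0$ (with $\varepsilon$ the trivial character), and $\lambda_{ij}+q_{ij}\lambda_{ji}=0$ for $i\neq j$. Then $H=H(\mathbf{g},\mathbf{\chi},\mathbf{\lambda})$ is the $\mathbf{k}$-algebra generated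 by $G$ (with the relations of $G$) and $x_1,\ldots,x_n$, subject to $gx_i=\chi_i(g)x_ig$ for $g\in G$; $x_ix_j=q_{ij}x_jx_i+\lambda_{ij}(1-g_ig_j)$ for $i\neq j$; $x_i^{m_i}=\lambda_i(1-g_i^{m_i})$. It is well known that $\{x_1^{r_1}\cdots x_n^{r_n}g:0\le r_i<m_i,\ g\in G\}$ is a basis of $H$. It is a Hopf algebra with $\Delta(g)=g\otimes g$, $\Delta(x_i)=g_i\otimes x_i+x_i\otimes 1$, counit $\varepsilon(g)=1$, $\varepsilon(x_i)=0$, antipode $S(g)=g^{-1}$, $S(x_i)=-g_i^{-1}x_i$. Nakayama automorphism: for a finite dimensional Hopf algebra $H$, a nonzero right integral $\varphi\in H^*$ (i.e. $\varphi * f=f(1)\varphi$ for all $f\in H^*$) is a Frobenius homomorphism, and $\rho$ is the algebra automorphism determined by $\varphi(ax)=\varphi(\rho(x)a)$ for all $a,x\in H$. It does not depend on the choice of $\varphi$, and it satisfies $\rho(h)=\alpha(S(h_{(1)}))S^2(h_{(2)})$. Modular element: if $t\in H$ is a nonzero right integral ($th=\varepsilon(h)t$ for all $h$), then $\alpha\colon H\to\mathbf{k}$ is the algebra map given by $ht=\alpha(h)t$. In the present case $\alpha(x_i)=0$ and $\alpha(g)=\chi_1^{m_1-1}(g)\cdots\chi_n^{m_n-1}(g)$ for $g\in G$; also $\rho(g)=\alpha(g^{-1})g$ and $\rho(x_i)=\alpha(g_i^{-1})q_{ii}^{-1}x_i$. *)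

(* Defs.v *)
From HB Require Import structures.
From mathcomp Require Import all_boot all_order all_algebra all_fingroup all_field.

Set Implicit Arguments.
Unset Strict Implicit.
Unset Printing Implicit Defensive.

Import GRing.Theory.
Local Open Scope ring_scope.

(* The tensor product of two finite-dimensional algebras A and B: an element
   is the matrix of its coordinates on the products a_i (x) b_j of the bases
   vbasis {:A} and vbasis {:B}. *)
Definition tensor (k : fieldType) (A B : falgType k) :=
  'M[k]_(\dim {:A}, \dim {:B}).

Section Tensor.
Variables (k : fieldType) (A B : falgType k).

HB.instance Definition _ := Vector.on (tensor A B).

Definition tens (u : A) (v : B) : tensor A B :=
  \matrix_(i, j) (coord (vbasis {:A}) i u * coord (vbasis {:B}) j v).

(* (u (x) v) * (u' (x) v') = u u' (x) v v', extended bilinearly. *)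
Definition tens_mul (s t : tensor A B) : tensor A B :=
  \sum_(i < \dim {:A}) \sum_(j < \dim {:B})
  \sum_(p < \dim {:A}) \sum_(r < \dim {:B})
    (s i j * t p r) *: tens ((vbasis {:A})`_i * (vbasis {:A})`_p)
                            ((vbasis {:B})`_j * (vbasis {:B})`_r).

Definition tens_one : tensor A B := tens 1 1.

(* (f (x) h)(u (x) v) = f u * h v, extended linearly. *)
Definition tens_eval (f : 'Hom(A, k^o)) (h : 'Hom(B, k^o)) (t : tensor A B) : k :=
  \sum_(i < \dim {:A}) \sum_(j < \dim {:B})
    t i j * ((f (vbasis {:A})`_i : k) * (h (vbasis {:B})`_j : k)).

Lemma tens_linearl v : linear (tens^~ v).
Proof.
by move=> c u u'; apply/matrixP=> i j; rewrite !mxE linearP mulrDl mulrA.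
Qed.

Lemma tens_linearr u : linear (tens u).
Proof.
by move=> c v v'; apply/matrixP=> i j; rewrite !mxE linearP mulrDr mulrCA.
Qed.

Lemma tens_sum (I J : Type) (r : seq I) (s : seq J) (F : I -> A) (G : J -> B)
    (a : I -> k) (b : J -> k) :
  tens (\sum_(i <- r) a i *: F i) (\sum_(j <- s) b j *: G j) =
  \sum_(i <- r) \sum_(j <- s) (a i * b j) *: tens (F i) (G j).
Proof.
apply/matrixP=> p q; rewrite !mxE !linear_sum mulr_suml summxE.
apply: eq_bigr => i _; rewrite mulr_sumr summxE; apply: eq_bigr => j _.
by rewrite !linearZ !mxE /= mulrACA.
Qed.

Lemma coord_vbasisT (V : vectType k) (v : V) :
  v = \sum_(i < \dim {:V}) coord (vbasis {:V}) i v *: (vbasis {:V})`_i.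
Proof. by apply: coord_vbasis; rewrite memvf. Qed.

Lemma tens_vbasis (i : 'I_(\dim {:A})) (j : 'I_(\dim {:B})) :
  tens (vbasis {:A})`_i (vbasis {:B})`_j = delta_mx i j.
Proof.
apply/matrixP=> p q; rewrite !mxE !coord_free ?(basis_free (vbasisP _)) //.
by rewrite -natrM mulnb ![_ == i]eq_sym ![_ == j]eq_sym.
Qed.

Lemma tens_coord (t : tensor A B) :
  t = \sum_(i < \dim {:A}) \sum_(j < \dim {:B})
        t i j *: tens (vbasis {:A})`_i (vbasis {:B})`_j.
Proof.
rewrite {1}[t]matrix_sum_delta; apply: eq_bigr => i _.
by apply: eq_bigr => j _; rewrite tens_vbasis.
Qed.

Lemma tens_ind (P : tensor A B -> Prop) :
    (forall u v, P (tens u v)) ->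
    (forall c s t, P s -> P t -> P (c *: s + t)) -> forall t, P t.
Proof.
move=> Ptens Plin t; rewrite [t]tens_coord.
have P0 : P 0 by have := Plin (-1) _ _ (Ptens 0 0) (Ptens 0 0); rewrite scaleN1r addNr.
have PD s s' : P s -> P s' -> P (s + s').
  by move=> Ps Ps'; rewrite -[s]scale1r; apply: Plin.
have PZ c s : P s -> P (c *: s).
  by move=> Ps; rewrite -[c *: s]addr0; apply: Plin.
by apply: big_ind => // i _; apply: big_ind => // j _; apply: PZ; apply: Ptens.
Qed.

Lemma tens_mul_linearl t : linear (tens_mul^~ t).
Proof.
move=> c s s'; rewrite /tens_mul scaler_sumr -big_split; apply: eq_bigr => i _.
rewrite scaler_sumr -big_split; apply: eq_bigr => j _.
rewrite scaler_sumr -big_split; apply: eq_bigr => p _.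
rewrite scaler_sumr -big_split; apply: eq_bigr => r _.
by rewrite /= !mxE mulrDl scalerDl scalerA mulrA.
Qed.

Lemma tens_mul_linearr s : linear (tens_mul s).
Proof.
move=> c t t'; rewrite /tens_mul scaler_sumr -big_split; apply: eq_bigr => i _.
rewrite scaler_sumr -big_split; apply: eq_bigr => j _.
rewrite scaler_sumr -big_split; apply: eq_bigr => p _.
rewrite scaler_sumr -big_split; apply: eq_bigr => r _.
by rewrite /= !mxE mulrDr scalerDl scalerA mulrCA.
Qed.

Lemma tens_mulE u v u' v' :
  tens_mul (tens u v) (tens u' v') = tens (u * u') (v * v').
Proof.
have mulE (C : falgType k) (a b : C) : a * b =
    \sum_(i < \dim {:C}) \sum_(p < \dim {:C})
     (coord (vbasis {:C}) i a * coord (vbasis {:C}) p b) *: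
       ((vbasis {:C})`_i * (vbasis {:C})`_p).
  rewrite {1}[a]coord_vbasisT {1}[b]coord_vbasisT mulr_suml.
  apply: eq_bigr => i _; rewrite mulr_sumr; apply: eq_bigr => p _.
  by rewrite -scalerAl -scalerAr scalerA.
rewrite (mulE A) (mulE B) !pair_bigA tens_sum /= /tens_mul.
rewrite -(pair_bigA _ (fun i p => \sum_(q : 'I_(\dim {:B}) * 'I_(\dim {:B}))
  (coord (vbasis {:A}) i u * coord (vbasis {:A}) p u' *
   (coord (vbasis {:B}) q.1 v * coord (vbasis {:B}) q.2 v')) *:
  tens ((vbasis {:A})`_i * (vbasis {:A})`_p)
       ((vbasis {:B})`_q.1 * (vbasis {:B})`_q.2))) /=.
apply: eq_bigr => i _; rewrite exchange_big; apply: eq_bigr => p _.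
rewrite pair_bigA; apply: eq_bigr => -[j r] _ /=.
by rewrite !mxE mulrACA.
Qed.

Lemma tens_evalE f h u v : tens_eval f h (tens u v) = (f u : k) * (h v : k).
Proof.
rewrite [u in RHS]coord_vbasisT [v in RHS]coord_vbasisT !linear_sum mulr_suml.
apply: eq_bigr => i _; rewrite mulr_sumr; apply: eq_bigr => j _.
by rewrite !linearZ mxE mulrACA.
Qed.

Lemma tens_mulA : associative tens_mul.
Proof.
elim/tens_ind => [u v|c s s' IH IH' t w]; last first.
  by rewrite !tens_mul_linearl IH IH'.
elim/tens_ind => [u' v'|c s s' IH IH' t]; last first.
  by rewrite !(tens_mul_linearl, tens_mul_linearr) IH IH'.
elim/tens_ind => [u2 v2|c s s' IH IH']; last by rewrite !tens_mul_linearr IH IH'.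
by rewrite !tens_mulE !mulrA.
Qed.

Lemma tens_mul1l : left_id tens_one tens_mul.
Proof.
elim/tens_ind => [u v|c s t IHs IHt]; first by rewrite tens_mulE !mul1r.
by rewrite tens_mul_linearr IHs IHt.
Qed.

Lemma tens_mul1r : right_id tens_one tens_mul.
Proof.
elim/tens_ind => [u v|c s t IHs IHt]; first by rewrite tens_mulE !mulr1.
by rewrite tens_mul_linearl IHs IHt.
Qed.

Lemma tens_mulDl : left_distributive tens_mul +%R.
Proof. by move=> s s' t; rewrite -[s]scale1r tens_mul_linearl !scale1r. Qed.

Lemma tens_mulDr : right_distributive tens_mul +%R.
Proof. by move=> s t t'; rewrite -[t]scale1r tens_mul_linearr !scale1r. Qed.

Lemma tens_one_neq0 : tens_one != 0.
Proof.
have coord1 (C : falgType k) : exists i, coord (vbasis {:C}) i (1 : C) != 0.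
  have [[i]|C0] := altP (@existsP _ (fun i => coord (vbasis {:C}) i 1 != 0)).
    by exists i.
  have /eqP[] := oner_neq0 C; rewrite [LHS]coord_vbasisT big1 // => i _.
  move: C0; rewrite negb_exists => /forallP/(_ i).
  by rewrite negbK => /eqP->; rewrite scale0r.
have [i ui] := coord1 A; have [j vj] := coord1 B.
apply/eqP=> /matrixP/(_ i j)/eqP; rewrite !mxE mulf_eq0.
by rewrite (negPf ui) (negPf vj).
Qed.

HB.instance Definition _ := GRing.Zmodule_isNzRing.Build (tensor A B)
  tens_mulA tens_mul1l tens_mul1r tens_mulDl tens_mulDr tens_one_neq0.

Lemma tens_scaleAl (c : k) (s t : tensor A B) : c *: (s * t) = (c *: s) * t.
Proof. exact: esym (GRing.scalable_linear (tens_mul_linearl t) c s). Qed.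

Lemma tens_scaleAr (c : k) (s t : tensor A B) : c *: (s * t) = s * (c *: t).
Proof. exact: esym (GRing.scalable_linear (tens_mul_linearr s) c t). Qed.

HB.instance Definition _ :=
  GRing.Lmodule_isLalgebra.Build k (tensor A B) tens_scaleAl.
HB.instance Definition _ :=
  GRing.Lalgebra_isAlgebra.Build k (tensor A B) tens_scaleAr.
HB.instance Definition _ := Algebra_isFalgebra.Build k (tensor A B).

End Tensor.

Section Lifting.
Variables (k : fieldType) (G : finGroupType) (n : nat).

(* A character takes its values in k^*, since chi a * chi a^-1 = 1. *)
Definition is_character (chi : G -> k) :=
  chi 1%g = 1 /\ forall a b, chi (a * b)%g = chi a * chi b.

Record lifting_data := LiftingData {
  ld_g : 'I_n -> G;
  ld_chi : 'I_n -> G -> k;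
  ld_m : 'I_n -> nat;
  ld_lam : 'I_n -> k;
  (* lambda_ij; the entries i = j are never used *)
  ld_lam2 : 'I_n -> 'I_n -> k
}.

Definition ld_q (D : lifting_data) (i j : 'I_n) : k := ld_chi D j (ld_g D i).

Record lifting_data_axioms (D : lifting_data) : Prop := {
  ld_char : forall i, is_character (ld_chi D i);
  ld_qii : forall i, ld_chi D i (ld_g D i) != 1;
  ld_qij : forall i j, i != j ->
    ld_chi D i (ld_g D j) * ld_chi D j (ld_g D i) = 1;
  ld_order : forall i, (ld_m D i).-primitive_root (ld_q D i i);
  ld_lamP : forall i a, ld_lam D i * (ld_chi D i a ^+ ld_m D i - 1) = 0;
  ld_lam2P : forall i j a, i != j ->
    ld_lam2 D i j * (ld_chi D i a * ld_chi D j a - 1) = 0;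
  ld_lam2_sym : forall i j, i != j ->
    ld_lam2 D i j + ld_q D i j * ld_lam2 D j i = 0
}.

Record lifting_relations (D : lifting_data) (A : algType k)
    (gamma : G -> A) (x : 'I_n -> A) : Prop := {
  lr_one : gamma 1%g = 1;
  lr_mul : forall a b, gamma (a * b)%g = gamma a * gamma b;
  lr_gx : forall a i, gamma a * x i = ld_chi D i a *: (x i * gamma a);
  lr_xx : forall i j, i != j ->
    x i * x j = ld_q D i j *: (x j * x i)
                + ld_lam2 D i j *: (1 - gamma (ld_g D i * ld_g D j)%g);
  lr_xm : forall i,
    x i ^+ ld_m D i = ld_lam D i *: (1 - gamma (ld_g D i ^+ ld_m D i)%g)
}.

(* H is the algebra presented by the generators G, x_1, ..., x_n and the
   relations above: the defining universal property. *)
Definition is_lifting (D : lifting_data) (H : algType k)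
    (gamma : G -> H) (x : 'I_n -> H) : Prop :=
  lifting_relations D gamma x /\
  forall (A : algType k) (gamma' : G -> A) (x' : 'I_n -> A),
    lifting_relations D gamma' x' ->
    exists2 f : {lrmorphism H -> A},
      (forall a, f (gamma a) = gamma' a) /\ (forall i, f (x i) = x' i)
    & forall f' : {lrmorphism H -> A},
      (forall a, f' (gamma a) = gamma' a) /\ (forall i, f' (x i) = x' i) ->
      f' =1 f.

Definition is_lifting_comul (D : lifting_data) (H : falgType k)
    (gamma : G -> H) (x : 'I_n -> H) (Delta : 'AHom(H, tensor H H)) : Prop :=
  (forall a, Delta (gamma a) = tens (gamma a) (gamma a)) /\
  (forall i, Delta (x i) = tens (gamma (ld_g D i)) (x i) + tens (x i) 1).

Definition is_lifting_counit (H : falgType k)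
    (gamma : G -> H) (x : 'I_n -> H) (eps : 'AHom(H, k^o)) : Prop :=
  (forall a, eps (gamma a) = 1) /\ (forall i, eps (x i) = 0).

End Lifting.

Section Integrals.
Variables (k : fieldType) (H : falgType k).

(* The value at a of the convolution product f * h in the dual of H. *)
Definition convolution (Delta : 'AHom(H, tensor H H))
    (f h : 'Hom(H, k^o)) (a : H) : k := tens_eval f h (Delta a).

Definition is_dual_right_integral (Delta : 'AHom(H, tensor H H))
    (phi : 'Hom(H, k^o)) : Prop :=
  forall (f : 'Hom(H, k^o)) (a : H),
    convolution Delta phi f a = (f 1 : k) * (phi a : k).

Definition is_right_integral (eps : 'AHom(H, k^o)) (t : H) : Prop :=
  forall h, t * h = (eps h : k) *: t.

Definition is_nakayama (phi : 'Hom(H, k^o)) (rho : 'AEnd(H)) : Prop :=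
  bijective rho /\ forall a x : H, phi (a * x) = phi (rho x * a).

Definition is_modular_element (eps : 'AHom(H, k^o)) (alpha : 'AHom(H, k^o)) : Prop :=
  exists t : H, [/\ t != 0, is_right_integral eps t
                  & forall h, h * t = (alpha h : k) *: t].

End Integrals.

(* The subgroup of k^* generated by a set S of nonzero elements. *)
Inductive generated_subgroup (k : fieldType) (S : k -> Prop) : k -> Prop :=
| gen_mem w : S w -> generated_subgroup S w
| gen_one : generated_subgroup S 1
| gen_mul w w' : generated_subgroup S w -> generated_subgroup S w' ->
    generated_subgroup S (w * w')
| gen_inv w : generated_subgroup S w -> generated_subgroup S w^-1.

Definition L1 (k : fieldType) (G : finGroupType) (n : nat)
    (D : lifting_data k G n) (H : falgType k) (gamma : G -> H)
    (alpha : 'AHom(H, k^o)) : k -> Prop :=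
  generated_subgroup (fun w =>
    (exists i, w = ld_q D i i) \/ (exists a, w = alpha (gamma a))).

(* Main.v *)
Require Import Defs.
From HB Require Import structures.
From mathcomp Require Import all_boot all_order all_algebra all_fingroup all_field.
From mathcomp Require Import ring.

Set Implicit Arguments.
Unset Strict Implicit.
Unset Printing Implicit Defensive.

Import GRing.Theory.
Local Open Scope ring_scope.

(** The algebra [H] has the basis of ordered monomials in the [x_i] with exponents
    [0 <= r_i < m_i], times the elements of [G] ([pbw_basis]), and [rho] is
    diagonal in it: [rho(g) = alpha(g)^-1 g] and
    [rho(x_i) = alpha(g_i)^-1 q_ii^-1 x_i] ([rho_gamma], [rho_x]). So the dimension
    of [H_w] is the number of pairs [(r, g)] of weight [w]. Replacing [g] by
    [g a^-1] multiplies all the weights by [alpha(a)]; raising [r_i] cyclically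
    modulo [m_i] while correcting [g] by a power of [g_i] multiplies them by
    [q_ii^-1], because [q_ii^(m_i) = 1]. These are permutations of the index set,
    so the number of pairs of weight [w] does not change when [w] is multiplied by
    a generator of [L1] ([multiplicity_L1]). The monomial 1 has weight 1, hence all
    the elements of [L1], and only these, occur as weights, equally often.

    The monomials span [H] because the relations reorder any word. Their
    independence needs a module on which [H] acts with a large cyclic orbit. It is
    built from the regular module of [G] by inducing along one generator at a time:
    the new module is the sum of the [x_i^t V] for [t < m_i], and the relations hold
    because all the overlaps with the new relations resolve ([ind_relations]). The
    result is cyclic of dimension [|G| m_1 ... m_n], a lower bound for the dimension
    of [H] ([lifting_dim_ge]).

    The values of [rho] come from the integral [phi]. A nonzero integral [psi] of the
    dual defines a nondegenerate form [psi(a b)] ([integral_nondegenerate]): its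
    radical is a left ideal and a right coideal, and the bijectivity of
    [a (x) b |-> a b_(1) (x) b_(2)] leaves only 0 and [H]. Consequently two integrals
    that agree at the integral [t] of [H] are equal. The functionals [phi(g^-1 a g)]
    and [phi(a x_i) - d phi(x_i a)], for a suitable scalar [d], are integrals; their
    values at [t], read off from [eps] and [alpha], identify them with
    [alpha(g^-1) phi] and 0, which gives [rho] on the generators. *)

(** * Linear identities and endomorphism algebras *)

Section VRing.
Variables (k : fieldType) (V : vectType k).
Notation e := (vbasis {:V}).

Lemma vcoordP (u v : V) : (forall i, coord e i u = coord e i v) -> u = v.
Proof.
move=> uv; rewrite [u]coord_vbasisT [v]coord_vbasisT.
by apply: eq_bigr => i _; rewrite uv.
Qed.

Lemma vcoordD i (u v : V) : coord e i (u + v) = coord e i u + coord e i v.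
Proof. exact: linearD. Qed.
Lemma vcoordN i (u : V) : coord e i (- u) = - coord e i u.
Proof. exact: linearN. Qed.
Lemma vcoordZ i c (u : V) : coord e i (c *: u) = c * coord e i u.
Proof. exact: linearZ. Qed.
Lemma vcoord0 i : coord e i (0 : V) = 0.
Proof. exact: linear0. Qed.
Definition vcoordE := (vcoordD, vcoordN, vcoordZ, vcoord0).
End VRing.

(** Coordinates turn a linear identity between vectors, however the vectors were
    obtained, into commutative identities between scalars. *)
Ltac vring := apply: vcoordP => ?; rewrite !vcoordE; ring.

Section Endo.
Variables (k : fieldType) (V : vectType k) (Vp : (0 < dim V)%N).

(** The product is composition, so that an algebra morphism into [endo] is a
    left module structure on [V]. *)
Definition endo_lalg : lalgType k := HB.pack 'End(V) (lfun_comp_nzRingType Vp)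
  (GRing.Lmodule_isLalgebra.Build k (lfun_comp_nzRingType Vp)
    (fun c f g => comp_lfunZl c f g)).

Definition endo : algType k := HB.pack 'End(V) endo_lalg
  (GRing.Lalgebra_isAlgebra.Build k endo_lalg (fun c f g => comp_lfunZr c f g)).

Definition app (f : endo) (v : V) : V := (f : 'End(V)) v.

Lemma endoP (f g : endo) : (forall v, app f v = app g v) -> f = g.
Proof. by move=> fg; apply/lfunP. Qed.
Lemma app_is_linear f : linear (app f).
Proof. exact: linearP. Qed.
HB.instance Definition _ f :=
  GRing.isSemilinear.Build k V V *:%R (app f) (GRing.semilinear_linear (app_is_linear f)).

Lemma fun_app (f : endo) (v : V) : fun_of_lfun f v = app f v. Proof. by []. Qed.
Lemma app1 v : app 1 v = v. Proof. exact: id_lfunE. Qed.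
Lemma appM f g v : app (f * g) v = app f (app g v). Proof. exact: comp_lfunE. Qed.
Lemma appD f g v : app (f + g) v = app f v + app g v. Proof. exact: add_lfunE. Qed.
Lemma appN f v : app (- f) v = - app f v. Proof. exact: opp_lfunE. Qed.
Lemma appZ c f v : app (c *: f) v = c *: app f v. Proof. exact: scale_lfunE. Qed.
Lemma app0 v : app 0 v = 0. Proof. exact: zero_lfunE. Qed.
Definition appE := (app1, appM, appD, appN, appZ, app0).

Lemma appDr f u v : app f (u + v) = app f u + app f v. Proof. exact: linearD. Qed.
Lemma appNr f v : app f (- v) = - app f v. Proof. exact: linearN. Qed.
Lemma appBr f u v : app f (u - v) = app f u - app f v. Proof. exact: linearB. Qed.
Lemma appZr f c v : app f (c *: v) = c *: app f v. Proof. exact: linearZ. Qed.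
End Endo.

(** * Characters, quantum integers and the relations of a lifting *)

Section Character.
Variables (k : fieldType) (G : finGroupType) (chi : G -> k).
Hypothesis chiP : is_character chi.

Lemma char_neq0 a : chi a != 0.
Proof.
apply/eqP=> a0; have [chi1 chiM] := chiP.
by have /eqP := chi1; rewrite -(mulgV a) chiM a0 mul0r eq_sym oner_eq0.
Qed.

Lemma charV a : chi a^-1%g = (chi a)^-1.
Proof.
have [chi1 chiM] := chiP.
by apply: (mulfI (char_neq0 a)); rewrite -chiM mulgV chi1 divff ?char_neq0.
Qed.

Lemma charX a r : chi (a ^+ r)%g = chi a ^+ r.
Proof.
have [chi1 chiM] := chiP; elim: r => [|r IH]; first by rewrite expg0 expr0.
by rewrite expgS exprS chiM IH.
Qed.
End Character.

Section QuantumInteger.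
Variables (k : fieldType) (p : k).

Definition qnum t := \sum_(r < t) p ^+ r.

Lemma qnum0 : qnum 0 = 0.
Proof. exact: big_ord0. Qed.

Lemma qnumS t : qnum t.+1 = 1 + p * qnum t.
Proof.
rewrite /qnum big_ord_recl expr0 mulr_sumr; congr (_ + _).
by apply: eq_bigr => r _; rewrite exprS.
Qed.

Lemma qnumSr t : qnum t.+1 = qnum t + p ^+ t.
Proof. by rewrite /qnum big_ord_recr. Qed.

Lemma qnum_root m : p != 1 -> p ^+ m = 1 -> qnum m = 0.
Proof.
move=> p1 pm; apply: (mulfI (x := p - 1)); first by rewrite subr_eq0.
by rewrite -subrX1 pm subrr mulr0.
Qed.
End QuantumInteger.

Section DirectPowers.
Variables (k : fieldType) (V : vectType k) (m : nat).
Notation W := {ffun 'I_m -> V}.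

Definition single_fun (t : nat) (v : V) : W :=
  [ffun r : 'I_m => if r == t :> nat then v else 0].
Lemma single_fun_linear t : linear (single_fun t).
Proof.
move=> c u v; apply/ffunP=> r; rewrite !ffunE.
by case: ifP; rewrite ?scaler0 ?addr0.
Qed.
HB.instance Definition _ t := GRing.isSemilinear.Build k V W *:%R (single_fun t)
  (GRing.semilinear_linear (single_fun_linear t)).

Definition proj_fun (r : 'I_m) (f : W) : V := f r.
Lemma proj_fun_linear r : linear (proj_fun r).
Proof. by move=> c u v; rewrite /proj_fun !ffunE. Qed.
HB.instance Definition _ r := GRing.isSemilinear.Build k W V *:%R (proj_fun r)
  (GRing.semilinear_linear (proj_fun_linear r)).

(** [single t v] is [v] placed at index [t]; it vanishes for [t >= m]. *)
Definition single t : 'Hom(V, W) := linfun (single_fun t).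

Lemma single_sum (f : W) : f = \sum_(r < m) single r (f r).
Proof.
apply/ffunP=> r; rewrite sum_ffunE (bigD1 r) //= big1 ?addr0 => [|t tr].
  by rewrite lfunE ffunE eqxx.
by rewrite lfunE ffunE; case: eqP => // rt; case/eqP: tr; apply: val_inj.
Qed.

Definition extend (F : nat -> 'Hom(V, W)) : 'End(W) :=
  \sum_(r < m) (F r \o linfun (proj_fun r))%VF.

Lemma extend_single F t v : (t < m)%N -> extend F (single t v) = F t v.
Proof.
move=> tm; rewrite sum_lfunE (bigD1 (Ordinal tm)) //= big1 ?addr0 => [|r rt].
  by rewrite comp_lfunE !lfunE /= /proj_fun ffunE eqxx.
rewrite comp_lfunE !lfunE /= /proj_fun ffunE; case: eqP => [e|_].
  by case/eqP: rt; apply: val_inj.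
by rewrite linear0.
Qed.

Lemma dim_ffun : dim W = (m * dim V)%N.
Proof. by rewrite -[LHS]/(#|'I_m| * dim V)%N card_ord. Qed.
End DirectPowers.

Section Relations.
Variables (k : fieldType) (G : finGroupType) (n : nat) (D : lifting_data k G n).

(** The relations between [G] and the generators indexed by [s] only: the
    generators are added to the module one at a time. *)
Record relations_on (s : seq 'I_n) (A : algType k) (gamma : G -> A)
    (x : 'I_n -> A) : Prop := {
  ro_one : gamma 1%g = 1;
  ro_mul : forall a b, gamma (a * b)%g = gamma a * gamma b;
  ro_gx : forall a i, i \in s -> gamma a * x i = ld_chi D i a *: (x i * gamma a);
  ro_xx : forall i j, i \in s -> j \in s -> i != j ->
    x i * x j = ld_q D i j *: (x j * x i)
                + ld_lam2 D i j *: (1 - gamma (ld_g D i * ld_g D j)%g);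
  ro_xm : forall i, i \in s ->
    x i ^+ ld_m D i = ld_lam D i *: (1 - gamma (ld_g D i ^+ ld_m D i)%g)
}.

Hypothesis axD : lifting_data_axioms D.

(** A primitive first root of unity is 1, which [q_ii] is not. *)
Lemma ld_m_gt1 i : (1 < ld_m D i)%N.
Proof.
have [pq nq] := (ld_order axD i, ld_qii axD i).
have := prim_order_gt0 pq; have := prim_expr_order pq.
case: (ld_m D i) => [|[|m]] //; rewrite expr1 /ld_q => q1.
by rewrite q1 eqxx in nq.
Qed.

Lemma ld_m_gt0 i : (0 < ld_m D i)%N.
Proof. exact: ltnW (ld_m_gt1 i). Qed.

Lemma lam2_char i j a : i != j -> ld_lam2 D i j = 0 \/ ld_chi D i a * ld_chi D j a = 1.
Proof.
move=> ij; have /eqP := ld_lam2P axD a ij; rewrite mulf_eq0 subr_eq0.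
by case/orP=> /eqP; [left | right].
Qed.

Lemma lam_char i a : ld_lam D i = 0 \/ ld_chi D i a ^+ ld_m D i = 1.
Proof.
have /eqP := ld_lamP axD i a; rewrite mulf_eq0 subr_eq0.
by case/orP=> /eqP; [left | right].
Qed.

End Relations.

(** * The module induced along a new generator *)

Section InducedModule.
Variables (k : fieldType) (G : finGroupType) (n : nat) (D : lifting_data k G n).
Hypotheses (abelG : abelian [set: G]) (axD : lifting_data_axioms D).
Variables (i : 'I_n) (s : seq 'I_n) (V : vectType k) (Vp : (0 < dim V)%N).
Variables (gam : G -> endo Vp) (x : 'I_n -> endo Vp).
Hypotheses (rel : relations_on D s gam x) (i_notin_s : i \notin s).

Notation m := (ld_m D i).
Notation chi := (ld_chi D i).
Notation lam := (ld_lam D i).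
Notation q j := (ld_chi D i (ld_g D j)).
Notation l j := (ld_lam2 D j i).
Notation K j := (ld_g D j * ld_g D i)%g.
Notation W := {ffun 'I_m -> V}.

Lemma abelC (a b : G) : (a * b = b * a)%g.
Proof. by apply: (centsP abelG); rewrite inE. Qed.

Lemma ind_dim_gt0 : (0 < dim W)%N.
Proof. by rewrite dim_ffun muln_gt0 (ld_m_gt0 axD i). Qed.
Notation E := (endo ind_dim_gt0).

Notation i0 := (single V m 0).

(** [W] is the sum of copies [x_i^t V], [t < m], and the following operators are
    the actions of [a], [x_i] and [x_j] that the relations dictate. Here [a] moves
    past [x_i^t] at the cost of [chi_i(a)^t]. *)
Definition ind_gamma (a : G) : E :=
  extend (fun t => chi a ^+ t *: (single V m t \o gam a)%VF).

Definition one_sub_gam c a : endo Vp := 1 - c *: gam a.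

Lemma one_sub_gamE c a v : fun_of_lfun (one_sub_gam c a) v = v - c *: app (gam a) v.
Proof. by rewrite fun_app /one_sub_gam (appD _ _ v) (appN _ v) (appZ _ _ v) (app1 _ v). Qed.

(** Multiplication by [x_i]; at the top degree it wraps around through
    [x_i^m = lambda_i (1 - g_i^m)]. *)
Definition ind_new : E :=
  extend (fun t => if (t.+1 < m)%N then single V m t.+1
    else lam *: (i0 \o one_sub_gam 1 (ld_g D i ^+ m)%g)%VF).

(** The value of [x_j x_i^t] on [V], obtained by moving [x_j] past one [x_i]
    after the other: with [p = q_ji], the [t] terms [lambda_ji (1 - g_j g_i)]
    produced on the way add up to
    [lambda_ji [t]_p x_i^(t-1) (1 - p^(t-1) g_j g_i)]. For [t = 0] the quantum
    integer is 0, whatever [t.-1] is. *)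
Definition ind_old_on j t : 'Hom(V, W) :=
  (q j ^+ t *: ((ind_new ^+ t : E) \o (i0 \o x j)) +
   (l j * qnum (q j) t) *: ((ind_new ^+ t.-1 : E) \o
     (i0 \o one_sub_gam (q j ^+ t.-1) (K j))))%VF.

Definition ind_old j : E := extend (ind_old_on j).

Lemma ind_gammaE a t v : (t < m)%N ->
  app (ind_gamma a) (single V m t v) = chi a ^+ t *: single V m t (app (gam a) v).
Proof. by move=> tm; rewrite /app extend_single // scale_lfunE comp_lfunE. Qed.

Lemma ind_newE t v : (t.+1 < m)%N -> app ind_new (single V m t v) = single V m t.+1 v.
Proof. by move=> tm; rewrite /app extend_single ?tm // ltnW. Qed.

Lemma ind_new_top t v : t.+1 = m ->
  app ind_new (single V m t v) = lam *: i0 (v - app (gam (ld_g D i ^+ m)%g) v).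
Proof.
move=> tm; rewrite /app extend_single -?tm ?ltnSn ?ltnn // scale_lfunE comp_lfunE.
by rewrite one_sub_gamE scale1r.
Qed.

Lemma ind_new_pow t v : (t < m)%N -> app (ind_new ^+ t) (i0 v) = single V m t v.
Proof.
elim: t => [|t IH] tm; first by rewrite expr0 app1.
by rewrite exprS appM IH ?ind_newE // ltnW.
Qed.

Lemma ind_new_powm v :
  app (ind_new ^+ m) (i0 v) = lam *: i0 (v - app (gam (ld_g D i ^+ m)%g) v).
Proof.
have e := prednK (ld_m_gt0 axD i).
have -> : ind_new ^+ m = ind_new * ind_new ^+ m.-1 by rewrite -exprS e.
by rewrite appM ind_new_pow ?ind_new_top // e.
Qed.

(** [W] is spanned by the powers of [x_i] applied to [V]. Every relation is
    therefore checked on [V] only, once the difference [F] of its two sides is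
    known to commute with [x_i] up to a scalar; computing [F x_i] resolves the
    overlap of that relation with the one between [x_j] and [x_i]. *)
Lemma ind_eq0 (F : E) c : (forall v, app F (i0 v) = 0) ->
  F * ind_new = c *: (ind_new * F) -> F = 0.
Proof.
move=> F0 FX; have Ft t v : app F (app (ind_new ^+ t) (i0 v)) = 0.
  elim: t => [|t IH]; first by rewrite expr0 app1.
  by rewrite exprS appM -appM FX appZ appM IH linear0 scaler0.
apply: endoP => f; rewrite app0 (single_sum f) linear_sum big1 //= => r _.
by rewrite -ind_new_pow // Ft.
Qed.

Lemma ind_ext (F F' : E) :
  (forall t v, (t < m)%N -> app F (single V m t v) = app F' (single V m t v)) -> F = F'.
Proof.
move=> FF; apply: endoP => f; rewrite (single_sum f) !linear_sum /=.
by apply: eq_bigr => r _; rewrite FF.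
Qed.

Lemma gamM a b v : app (gam (a * b)%g) v = app (gam a) (app (gam b) v).
Proof. by rewrite (ro_mul rel) appM. Qed.
Lemma gamC a b v : app (gam a) (app (gam b) v) = app (gam b) (app (gam a) v).
Proof. by rewrite -!gamM abelC. Qed.

Lemma ind_gamma1 : ind_gamma 1%g = 1.
Proof.
apply: ind_ext => t v tm; have [chi1 _] := ld_char axD i.
by rewrite ind_gammaE // (ro_one rel) !app1 chi1 expr1n scale1r.
Qed.

Lemma ind_gammaM a b : ind_gamma (a * b)%g = ind_gamma a * ind_gamma b.
Proof.
apply: ind_ext => t v tm; have [_ chiM] := ld_char axD i.
rewrite appM !ind_gammaE // appZr ind_gammaE // gamM scalerA.
by rewrite chiM exprMn mulrC.
Qed.

Lemma ind_gammaC a b : ind_gamma a * ind_gamma b = ind_gamma b * ind_gamma a.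
Proof. by rewrite -!ind_gammaM abelC. Qed.

Lemma ind_gamma_new a : ind_gamma a * ind_new = chi a *: (ind_new * ind_gamma a).
Proof.
apply: ind_ext => t v; rewrite appZ !appM leq_eqVlt => /orP[/eqP tm|tm].
  rewrite ind_new_top // appZr !ind_gammaE ?tm ?ld_m_gt0 //.
  rewrite appZr ind_new_top // !scalerA expr0 mulr1 -exprS tm.
  have [->|->] := lam_char axD i a; first by rewrite mulr0 !scale0r.
  by rewrite mul1r linearB /= gamC.
rewrite ind_newE // !ind_gammaE // ?appZr ?ind_newE ?(ltnW tm) //.
by rewrite scalerA exprS.
Qed.

Lemma ind_new_order :
  ind_new ^+ m = lam *: (1 - ind_gamma (ld_g D i ^+ m)%g).
Proof.
apply/eqP; rewrite -subr_eq0; apply/eqP/(@ind_eq0 _ 1) => [v|].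
  rewrite !appE ind_new_powm ind_gammaE ?ld_m_gt0 // expr0 scale1r.
  by rewrite linearB subrr.
rewrite scale1r mulrBl mulrBr -exprS -exprSr; congr (_ - _).
rewrite -scalerAl -scalerAr mulrBl mulrBr mul1r mulr1 ind_gamma_new.
have chiX := charX (ld_char axD i) (ld_g D i) m.
by rewrite chiX (prim_expr_order (ld_order axD i)) scale1r.
Qed.

Section Old.
Variable (j : 'I_n).
Hypothesis js : j \in s.

Lemma old_neq_new : j != i. Proof. by apply: contraNneq i_notin_s => <-. Qed.

(** If [lambda_ji <> 0] then [chi_j chi_i = 1], which together with
    [q_ij q_ji = 1] forces [q_ji = q_ii]. *)
Lemma link_q : l j = 0 \/ q j = ld_q D i i.
Proof.
have [|e] := lam2_char axD (ld_g D i) old_neq_new; [by left | right].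
apply: (mulfI (char_neq0 (ld_char axD j) (ld_g D i))).
by rewrite (ld_qij axD old_neq_new) e.
Qed.

Lemma qnum_eq0 : l j = 0 \/ qnum (q j) m = 0 /\ q j ^+ m = 1.
Proof.
have [|->] := link_q; [by left | right].
have qm := prim_expr_order (ld_order axD i).
by rewrite qnum_root //; apply: ld_qii axD i.
Qed.

Lemma lam_q : lam = 0 \/ q j ^+ m = 1. Proof. exact: lam_char axD i _. Qed.

Definition old_on t v : W :=
  q j ^+ t *: app (ind_new ^+ t) (i0 (app (x j) v)) +
  (l j * qnum (q j) t) *:
    app (ind_new ^+ t.-1) (i0 (v - q j ^+ t.-1 *: app (gam (K j)) v)).

Lemma ind_old_on_pow t v : (t < m)%N ->
  app (ind_old j) (app (ind_new ^+ t) (i0 v)) = old_on t v.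
Proof.
move=> tm; rewrite ind_new_pow // /app extend_single // add_lfunE !scale_lfunE.
by rewrite !comp_lfunE /old_on one_sub_gamE.
Qed.

Lemma ind_old0 v : app (ind_old j) (i0 v) = i0 (app (x j) v).
Proof.
have := ind_old_on_pow v (ld_m_gt0 axD i); rewrite expr0 app1 => ->.
by rewrite /old_on qnum0 mulr0 scale0r addr0 !expr0 scale1r app1.
Qed.

(** The formula for [x_j x_i^t] also holds at the wrap-around [t = m]: the quantum
    integer [[m]_(q_ii)] vanishes, and [g_i^m] commutes with [x_j] when
    [lambda_i <> 0]. *)
Lemma ind_old_powm v :
  app (ind_old j) (app (ind_new ^+ m) (i0 v)) = old_on m v.
Proof.
rewrite ind_new_powm appZr ind_old0 /old_on.
have -> : l j * qnum (q j) m = 0.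
  by have [->|[-> _]] := qnum_eq0; rewrite ?mul0r ?mulr0.
rewrite scale0r addr0 ind_new_powm scalerA.
have [->|qm] := lam_q; first by rewrite mulr0 !scale0r.
rewrite qm mul1r linearB /= -!appM (ro_gx rel) // appZ.
rewrite (charX (ld_char axD j)).
have /eqP := congr1 (fun c => c ^+ m) (ld_qij axD old_neq_new).
by rewrite exprMn qm expr1n mulr1 => /eqP ->; rewrite scale1r.
Qed.

Lemma ind_old_new : ind_old j * ind_new =
  q j *: (ind_new * ind_old j) + l j *: (1 - ind_gamma (K j)).
Proof.
apply: ind_ext => t v tm.
have -> : app (ind_old j * ind_new) (single V m t v) = old_on t.+1 v.
  rewrite -ind_new_pow // appM -[app ind_new _]appM -exprS.
  move: tm; rewrite leq_eqVlt => /orP[/eqP ->|tm]; first exact: ind_old_powm.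
  exact: ind_old_on_pow.
rewrite appD !appZ appM appD appN app1 ind_gammaE //.
rewrite -(ind_new_pow v tm) -(ind_new_pow (app (gam (K j)) v) tm).
rewrite ind_old_on_pow // /old_on appDr !appZr.
rewrite -[app ind_new (app _ _)]appM -exprS.
set a := app (ind_new ^+ t.+1) _; set w := app (gam (K j)) v.
have i0B c (u u' : V) : i0 (u - c *: u') = i0 u - c *: i0 u'.
  by rewrite linearB linearZ.
rewrite !i0B !appBr !appZr.
set b := app _ (i0 v); set b' := app _ (i0 w).
have -> : (l j * qnum (q j) t) *: (app ind_new (app (ind_new ^+ t.-1) (i0 v))
     - q j ^+ t.-1 *: app ind_new (app (ind_new ^+ t.-1) (i0 w)))
   = (l j * qnum (q j) t) *: (b - q j ^+ t.-1 *: b').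
  case: t tm @a @b @b' => [|t] tm a b b'; last by rewrite /b /b' exprS !appM.
  by rewrite qnum0 mulr0 !scale0r.
have [_ chiM] := ld_char axD i.
have [->|e] := link_q.
  by rewrite !mul0r !scale0r !addr0 scalerA exprS.
have -> : chi (K j) = q j * q j by rewrite chiM -/(ld_q D i i) -e.
have e1 := qnumSr (q j) t; rewrite [qnum _ t.+1]qnumS in e1 *.
case: t tm @a @b @b' e1 => [|t] tm a b b' e1.
  by rewrite qnum0 /=; vring.
have e2 : qnum (q j) t.+1 = 1 + q j * qnum (q j) t.+1 - q j ^+ t.+1.
  by rewrite e1 addrK.
apply: vcoordP => r; rewrite !vcoordE /=; rewrite !exprMn !exprS in e2 *.
move: (coord _ r a) (coord _ r b) (coord _ r b') e2.
move: (qnum _ t.+1) => Q u v1 v2 e2.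
(* The two sides differ by a multiple of the discrepancy between the two
   recursions of the quantum integer Q, that is of e2. *)
apply/eqP; rewrite -subr_eq0; apply/eqP.
transitivity (l j * (q j * q j ^+ t) * v2 * (Q - (1 + q j * Q - q j * q j ^+ t))).
  ring.
by rewrite -e2 subrr mulr0.
Qed.
End Old.

Section OldRelations.
Lemma i0D (u v : V) : i0 (u + v) = i0 u + i0 v. Proof. exact: linearD. Qed.
Lemma i0N (v : V) : i0 (- v) = - i0 v. Proof. exact: linearN. Qed.
Lemma i0Z c (v : V) : i0 (c *: v) = c *: i0 v. Proof. exact: linearZ. Qed.
Notation Y := ind_old.
Notation gi := (ld_g D i).

Lemma newE a w : app (ind_gamma a) (app ind_new w) =
  chi a *: app ind_new (app (ind_gamma a) w).
Proof. by rewrite -!appM ind_gamma_new appZ. Qed.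

Lemma oldE j w : j \in s -> app (Y j) (app ind_new w) =
  q j *: app ind_new (app (Y j) w) + l j *: (w - app (ind_gamma (K j)) w).
Proof. by move=> js; rewrite -!appM ind_old_new // !appE. Qed.

Lemma gammaCE a b w : app (ind_gamma a) (app (ind_gamma b) w) =
  app (ind_gamma b) (app (ind_gamma a) w).
Proof. by rewrite -!appM ind_gammaC. Qed.

Lemma ind_gamma0 a v : app (ind_gamma a) (i0 v) = i0 (app (gam a) v).
Proof. by rewrite ind_gammaE ?ld_m_gt0 // expr0 scale1r. Qed.

(** The only obstruction is the factor [lambda_ji (1 - chi_j chi_i (a))]. *)
Lemma ind_gamma_old a j : j \in s ->
  ind_gamma a * Y j = ld_chi D j a *: (Y j * ind_gamma a).
Proof.
move=> js; apply/eqP; rewrite -subr_eq0; apply/eqP.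
apply: (@ind_eq0 _ (chi a * q j)) => [v|].
  rewrite !appE ind_gamma0 ind_old0 // ind_gamma0 ind_old0 // -!appM (ro_gx rel) //.
  by rewrite appZ linearZ subrr.
apply: endoP => w.
rewrite !(appE, newE, oldE, appZr, appDr, appNr) // -(gammaCE a).
have [->|e] := lam2_char axD a (old_neq_new js); first by vring.
have c0 := char_neq0 (ld_char axD i) a.
have -> : ld_chi D j a = (chi a)^-1 by apply: (mulIf c0); rewrite e mulVf.
by apply: vcoordP => r; rewrite !vcoordE; field.
Qed.

Lemma oldgE a j w : j \in s ->
  app (ind_gamma a) (app (Y j) w) = ld_chi D j a *: app (Y j) (app (ind_gamma a) w).
Proof. by move=> js; rewrite -!appM ind_gamma_old // appZ. Qed.

(** Overlap of [x_j x_h] with [x_i]: each of the three scalars [lambda_ji],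
    [lambda_hi], [lambda_jh] comes with a factor that vanishes as soon as the
    scalar does not, because the corresponding product of characters is trivial. *)
Lemma ind_old_old j h : j \in s -> h \in s -> j != h ->
  Y j * Y h = ld_q D j h *: (Y h * Y j)
              + ld_lam2 D j h *: (1 - ind_gamma (ld_g D j * ld_g D h)%g).
Proof.
move=> js hs jh; have [ji hi] := (old_neq_new js, old_neq_new hs).
have [_ ciM] := ld_char axD i; have [_ cjM] := ld_char axD j.
have [_ chM] := ld_char axD h.
apply/eqP; rewrite -subr_eq0; apply/eqP.
apply: (@ind_eq0 _ (q j * q h)) => [v|].
  rewrite !appE !ind_old0 // ind_gamma0 -!appM (ro_xx rel) // !appE.
  rewrite !(i0D, i0N, i0Z); vring.
apply: endoP => w.
rewrite !(appE, newE, oldE, appZr, appDr, appNr, oldgE) // /ld_q.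
have Ej : l j = 0 \/ q h = ld_chi D h (ld_g D j) /\ ld_chi D h (K j) = 1.
  have [|e] := lam2_char axD (ld_g D h) ji; [by left | right].
  have e1 : q h = ld_chi D h (ld_g D j).
    apply: (mulfI (char_neq0 (ld_char axD j) (ld_g D h))).
    by rewrite e (ld_qij axD jh).
  by split=> //; rewrite chM -e1 mulrC (ld_qij axD hi).
have Eh : l h = 0 \/ ld_chi D h (ld_g D j) * q j = 1 /\ ld_chi D j (K h) = 1.
  have [|e] := lam2_char axD (ld_g D j) hi; [by left | right].
  split=> //; rewrite -[RHS](mulr1 1) -{1}(ld_qij axD jh) -(ld_qij axD ji).
  by rewrite mulrACA e mulr1 cjM.
have Ejh : ld_lam2 D j h = 0 \/
    q j * q h = 1 /\ chi (ld_g D j * ld_g D h)%g = 1.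
  have [|e] := lam2_char axD gi jh; [by left | right].
  suff e1 : q j * q h = 1 by rewrite ciM.
  rewrite -[RHS](mulr1 1) -{1}(ld_qij axD ji) -(ld_qij axD hi).
  by rewrite mulrACA e mul1r.
have qj0 := char_neq0 (ld_char axD i) (ld_g D j).
apply: vcoordP => r; rewrite !vcoordE.
move: (ld_chi D h (K j)) (ld_chi D j (K h)) (chi (ld_g D j * ld_g D h)%g)
  (l j) (l h) (ld_lam2 D j h) (q h) (ld_chi D h (ld_g D j)) (q j) qj0
  Ejh Ej Eh => c1 c2 c3 lj lh ljh b c a a0.
have inv z : z * a = 1 -> z = a^-1.
  by move=> za; apply: (mulIf a0); rewrite za mulVf.
have inv' z : a * z = 1 -> z = a^-1 by rewrite mulrC => /inv.
(* A nonzero lambda makes its c_ equal to 1 and ties b or c to a = q_ji. *)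
by case=> [->|[/inv'-> ->]]; case=> [->|[<- ->]]; case=> [->|[/inv e1 ->]];
  try rewrite e1; field.
Qed.

(** The second quantum integer is the one of the inverse root: if
    [lambda_ji <> 0], then [q_ji = q_jj^-1] and [q_ji chi_j(g_j g_i) = q_jj]. At
    exponent [m_j] both quantum integers vanish, so that [x_j^(m_j)] commutes with
    [x_i] up to a scalar. *)
Lemma old_pow_new j r w : j \in s -> app (Y j ^+ r.+1) (app ind_new w) =
  q j ^+ r.+1 *: app ind_new (app (Y j ^+ r.+1) w) +
  l j *: app (Y j ^+ r) (qnum (q j) r.+1 *: w -
    qnum (q j * ld_chi D j (K j)) r.+1 *: app (ind_gamma (K j)) w).
Proof.
move=> js; elim: r => [|r IH].
  by rewrite !expr1 expr0 app1 oldE // /qnum !big_ord1 !expr0 !scale1r.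
have gpow t u : app (ind_gamma (K j)) (app (Y j ^+ t) u) =
    ld_chi D j (K j) ^+ t *: app (Y j ^+ t) (app (ind_gamma (K j)) u).
  elim: t u => [|t IHt] u; first by rewrite !expr0 !app1 scale1r.
  by rewrite !exprSr !appM IHt oldgE // appZr scalerA.
rewrite exprS appM IH appDr !appZr oldE // gpow.
have YY t u : app (Y j) (app (Y j ^+ t) u) = app (Y j ^+ t.+1) u.
  by rewrite exprS appM.
rewrite !YY !(appDr, appNr, appZr) [qnum _ r.+2]qnumSr [qnum (_ * _) r.+2]qnumSr.
rewrite exprMn [q j ^+ r.+2]exprSr.
vring.
Qed.

Lemma ind_old_order j : j \in s ->
  Y j ^+ ld_m D j = ld_lam D j *: (1 - ind_gamma (ld_g D j ^+ ld_m D j)%g).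
Proof.
move=> js; have ji := old_neq_new js; set mj := ld_m D j.
apply/eqP; rewrite -subr_eq0; apply/eqP/(@ind_eq0 _ (q j ^+ mj)) => [v|].
  have powE t : app (Y j ^+ t) (i0 v) = i0 (app (x j ^+ t) v).
    elim: t => [|t IH]; first by rewrite !expr0 !app1.
    by rewrite !exprS !appM IH ind_old0.
  rewrite !appE powE ind_gamma0 (ro_xm rel) // !appE.
  by rewrite i0Z i0D i0N; vring.
apply: endoP => w.
have mjE : mj = mj.-1.+1 by rewrite prednK // ld_m_gt0.
have powE : app (Y j ^+ mj) (app ind_new w) =
    q j ^+ mj *: app ind_new (app (Y j ^+ mj) w).
  rewrite mjE old_pow_new // -mjE.
  have [->|e] := lam2_char axD (ld_g D j) ji; first by rewrite scale0r addr0.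
  have [_ cjM] := ld_char axD j.
  have qj : ld_chi D j (ld_g D j) != 0 := char_neq0 (ld_char axD j) _.
  have e1 : q j = (ld_q D j j)^-1.
    by apply: (mulfI qj); rewrite e divff.
  have e2 : q j * ld_chi D j (K j) = ld_q D j j.
    by rewrite cjM mulrCA [q j * _]mulrC (ld_qij axD ji) mulr1.
  have qm := prim_expr_order (ld_order axD j); have q1 := ld_qii axD j.
  rewrite e2 e1 !qnum_root //.
  - by rewrite !scale0r subrr linear0 scaler0 addr0.
  - by rewrite -/(ld_q D j j) in q1; apply: contraNneq q1 => /(canRL invrK)->; rewrite invr1.
  - by rewrite exprVn qm invr1.
rewrite !(appE, newE) powE.
have e : ld_lam D j = 0 \/
    q j ^+ mj = 1 /\ chi (ld_g D j ^+ mj)%g = 1.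
  have [|e] := lam_char axD j gi; [by left | right].
  suff e1 : q j ^+ mj = 1 by rewrite (charX (ld_char axD i)).
  by rewrite -[RHS](expr1n _ mj) -(ld_qij axD ji) exprMn e mul1r.
rewrite appDr appNr appZr appDr appNr.
case: e => [->|[-> ->]]; vring.
Qed.
End OldRelations.

Definition ind_x j : E := if j == i then ind_new else ind_old j.

Lemma ind_relations : relations_on D (i :: s) ind_gamma ind_x.
Proof.
have in_s j : j \in i :: s -> j != i -> j \in s.
  by rewrite inE => /orP[-> //|].
split.
- exact: ind_gamma1.
- exact: ind_gammaM.
- move=> a j js; rewrite /ind_x; case: eqP => [->|/eqP ji].
    exact: ind_gamma_new.
  exact: ind_gamma_old (in_s _ js ji).
- move=> j h js hs jh; rewrite /ind_x; case: (eqVneq j i) => [ji|ji].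
    case: (eqVneq h i) => [hi|hi]; first by rewrite ji hi eqxx in jh.
    subst j; rewrite ind_old_new; last exact: in_s.
    have ih : i != h by rewrite eq_sym.
    rewrite [(ld_g D i * _)%g]abelC scalerDr !scalerA [X in X *: (_ * _)](ld_qij axD hi).
    rewrite scale1r -addrA -scalerDl addrC [_ + ld_lam2 D i h]addrC.
    by rewrite (ld_lam2_sym axD ih) scale0r add0r.
  case: (eqVneq h i) => [hi|hi]; last exact: ind_old_old (in_s _ js ji) (in_s _ hs hi) jh.
  by subst h; rewrite ind_old_new //; apply: in_s.
- move=> j js; rewrite /ind_x; case: eqP => [->|/eqP ji].
    exact: ind_new_order.
  exact: ind_old_order (in_s _ js ji).
Qed.

(** [v] generates the module under [G] and the generators indexed by [s0]. *)
Definition cyclic_for (s0 : seq 'I_n) (V0 : vectType k) (V0p : (0 < dim V0)%N)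
    (g0 : G -> endo V0p) (x0 : 'I_n -> endo V0p) (v : V0) : Prop :=
  forall U : {vspace V0}, v \in U ->
    (forall a u, u \in U -> app (g0 a) u \in U) ->
    (forall j u, j \in s0 -> u \in U -> app (x0 j) u \in U) -> forall u, u \in U.

Lemma ind_cyclic v : cyclic_for s gam x v -> cyclic_for (i :: s) ind_gamma ind_x (i0 v).
Proof.
move=> cyc U vU gU xU.
have i0U u : i0 u \in U.
  rewrite memv_preim; apply: cyc => [|a w|j w js]; rewrite -!memv_preim //.
    by move=> wU; rewrite -ind_gamma0; apply: gU.
  move=> wU; rewrite -ind_old0 //; have := xU j _ _ wU.
  by rewrite /ind_x (negPf (old_neq_new js)); apply; rewrite inE js orbT.
have XU t u : app (ind_new ^+ t) (i0 u) \in U.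
  elim: t => [|t IH]; first by rewrite expr0 app1.
  rewrite exprS appM; have := xU i _ (mem_head _ _) IH.
  by rewrite /ind_x eqxx.
by move=> f; rewrite (single_sum f) memv_suml // => r _; rewrite -ind_new_pow.
Qed.
End InducedModule.

(** * A lower bound for the dimension *)

Section RegularModule.
Variables (k : fieldType) (G : finGroupType) (n : nat) (D : lifting_data k G n).
Notation V := {ffun G -> k^o}.

Lemma dim_regular : dim V = #|G|.
Proof. by rewrite -[LHS]/(#|G| * 1)%N muln1. Qed.

Lemma regular_dim_gt0 : (0 < dim V)%N.
Proof. by rewrite dim_regular; apply/card_gt0P; exists 1%g. Qed.

Definition translate_fun (a : G) (f : V) : V := [ffun b => f (a^-1 * b)%g].
Lemma translate_linear a : linear (translate_fun a).
Proof. by move=> c f g; apply/ffunP=> b; rewrite !ffunE. Qed.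
HB.instance Definition _ a := GRing.isSemilinear.Build k V V *:%R (translate_fun a)
  (GRing.semilinear_linear (translate_linear a)).
Definition translate a : endo regular_dim_gt0 := linfun (translate_fun a).

Lemma translateE a f b : app (translate a) f b = f (a^-1 * b)%g.
Proof. by rewrite /app lfunE ffunE. Qed.

Lemma regular_relations : relations_on D [::] translate (fun=> 0).
Proof.
split=> // [|a b]; apply: endoP => f; apply/ffunP=> c; rewrite appE.
  by rewrite translateE invg1 mul1g.
by rewrite !translateE invMg mulgA.
Qed.

Lemma regular_cyclic :
  cyclic_for ([::] : seq 'I_n) translate (fun=> 0) ([ffun b => (b == 1%g)%:R] : V).
Proof.
move=> U U1 gU _ f.
have -> : f = \sum_a f a *: app (translate a) [ffun b => (b == 1%g)%:R].
  apply/ffunP=> b; rewrite sum_ffunE (bigD1 b) //= big1 => [|a ab].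
    by rewrite ffunE translateE ffunE mulVg eqxx addr0 [_ *: _]mulr1.
  rewrite ffunE translateE ffunE -eq_mulVg1 (negPf ab).
  exact: mulr0.
by rewrite memv_suml // => a _; rewrite memvZ // gU.
Qed.
End RegularModule.

Section LowerBound.
Variables (k : fieldType) (G : finGroupType) (n : nat) (D : lifting_data k G n).
Hypotheses (abelG : abelian [set: G]) (axD : lifting_data_axioms D).

(** Start from the regular module of [G] and induce along each index of [s]. *)
Lemma exists_cyclic_module (s : seq 'I_n) : uniq s ->
  exists (V : vectType k) (Vp : (0 < dim V)%N) (gam : G -> endo Vp)
    (x : 'I_n -> endo Vp) (v : V),
  [/\ relations_on D s gam x, cyclic_for s gam x v &
      dim V = (#|G| * \prod_(i <- s) ld_m D i)%N].
Proof.
elim: s => [_|i s IH /= /andP[i_s us]].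
  exists _, (regular_dim_gt0 k G), (@translate k G), (fun=> 0), [ffun b => (b == 1%g)%:R].
  split; [exact: regular_relations | exact: regular_cyclic |].
  by rewrite dim_regular big_nil muln1.
have [V [Vp [gam [x [v [rel cyc dimV]]]]]] := IH us.
exists _, (ind_dim_gt0 axD i Vp), (ind_gamma axD i gam), (ind_x axD i gam x).
exists (single V (ld_m D i) 0 v); split.
- exact: ind_relations.
- exact: ind_cyclic.
- by rewrite dim_ffun dimV big_cons mulnCA.
Qed.

Variables (H : falgType k) (gamma : G -> H) (x : 'I_n -> H).
Hypothesis presH : is_lifting D gamma x.

(** By the universal property [H] acts on the cyclic module built from all the
    generators, and acting on the cyclic vector maps [H] onto that module. *)
Lemma lifting_dim_ge : (#|G| * \prod_i ld_m D i <= \dim {:H})%N.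
Proof.
have [V [Vp [gam [y [v [rel cyc dimV]]]]]] :=
  exists_cyclic_module (index_enum_uniq _ : uniq (index_enum 'I_n)).
have rel' : lifting_relations D gam y.
  case: rel => r1 r2 r3 r4 r5; split=> //.
  - by move=> a i; rewrite r3 ?mem_index_enum.
  - by move=> i j; apply: r4; rewrite mem_index_enum.
  - by move=> i; rewrite r5 ?mem_index_enum.
have [_ /(_ _ _ _ rel')[f [fg fx] _]] := presH.
have ev_lin : linear (fun h => app (f h) v).
  by move=> c h h'; rewrite linearP !appE.
pose evm := GRing.isSemilinear.Build k H V *:%R (fun h => app (f h) v)
  (GRing.semilinear_linear ev_lin).
pose ev : {linear H -> V} := HB.pack (fun h => app (f h) v) evm.
have evE h : linfun ev h = app (f h) v by rewrite lfunE.
have full u : u \in limg (linfun ev).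
  apply: cyc => [|a w /memv_imgP[h _ ->]|j w _ /memv_imgP[h _ ->]].
  - by apply/memv_imgP; exists 1; rewrite ?memvf // evE rmorph1 app1.
  - apply/memv_imgP; exists (gamma a * h); rewrite ?memvf //.
    by rewrite !evE rmorphM /= fg appM.
  apply/memv_imgP; exists (x j * h); rewrite ?memvf //.
  by rewrite !evE rmorphM /= fx appM.
rewrite -dimV -dimvf -(limg_ker_dim (linfun ev) {:H}); apply: leq_trans (leq_addl _ _).
by apply: dimvS; apply/subvP.
Qed.
End LowerBound.

(** * The Poincare-Birkhoff-Witt basis *)

Section Spanning.
Variables (k : fieldType) (G : finGroupType) (n : nat) (D : lifting_data k G n).
Hypotheses (abelG : abelian [set: G]) (axD : lifting_data_axioms D).
Variables (H : falgType k) (gamma : G -> H) (x : 'I_n -> H).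
Hypothesis presH : is_lifting D gamma x.
Let relH : lifting_relations D gamma x := proj1 presH.
Notation m := (ld_m D).

(** The subalgebra generated by [G] and the [x_i] satisfies the relations of [H].
    The resulting morphism from [H] to it, followed by the inclusion, is the
    identity by the uniqueness part of the universal property. *)
Lemma lifting_generated (U : {vspace H}) : 1 \in U ->
  (forall a u, u \in U -> gamma a * u \in U) ->
  (forall i u, u \in U -> x i * u \in U) -> forall u, u \in U.
Proof.
move=> U1 gU xU; set S := <<codom gamma ++ codom x>>%VS.
have Sg a : gamma a \in S by rewrite memv_span // mem_cat codom_f.
have Sx i : x i \in S by rewrite memv_span // mem_cat codom_f orbT.
have SA u : u \in S -> u \in agenv_aspace S by apply/subvP/sub_agenv.
have A1 : algid (agenv_aspace S) = 1.
  by apply/eqP; rewrite algid_eq1 memvE sub1_agenv.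
pose g' a := Subvs (SA _ (Sg a)); pose x' i := Subvs (SA _ (Sx i)).
have valA1 : vsval (1 : subvs_of (agenv_aspace S)) = 1 by [].
have valM (a b : subvs_of (agenv_aspace S)) : vsval (a * b) = vsval a * vsval b by [].
have valX (a : subvs_of (agenv_aspace S)) r : vsval (a ^+ r) = vsval a ^+ r.
  by elim: r => [|r IH]; rewrite ?expr0 // !exprS valM IH.
have rel' : lifting_relations D g' x'.
  case: relH => r1 r2 r3 r4 r5; split=> *; apply: val_inj.
  - by rewrite /= r1 A1.
  - exact: r2.
  - by rewrite linearZ /= r3.
  - rewrite linearD !linearZ linearB /= A1; exact: r4.
  - rewrite linearZ linearB /= valX A1; exact: r5.
have [_ univ] := presH.
have [f [fg fx] _] := univ _ _ _ rel'.
have [id0 _ uniqH] := univ _ _ _ relH.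
pose fv h := vsval (f h).
have fvlin : linear fv by move=> c u v; rewrite /fv !linearP.
have fvM : monoid_morphism fv.
  by split=> [|u v]; rewrite /fv ?rmorph1 ?rmorphM ?valA1 //= A1.
pose fvr : {lrmorphism H -> H} := HB.pack fv
  (GRing.isSemilinear.Build k H H *:%R fv (GRing.semilinear_linear fvlin))
  (GRing.isMonoidMorphism.Build H H fv fvM).
have idE : idfun =1 fvr.
  move=> h; rewrite (uniqH fvr) -?(uniqH idfun) //.
  by split=> [a|i]; rewrite /= /fv ?fg ?fx.
have SU : (agenv S <= U)%VS.
  apply: agenv_sub_modl; first by rewrite -memvE.
  apply/prodvP=> u v; rewrite /S => uS vU.
  have : (S <= amulr v @^-1: U)%VS.
    apply/span_subvP=> w; rewrite mem_cat => /orP[]/codomP[y ->];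
      by rewrite -memv_preim lfunE /= ?gU ?xU.
  by move/subvP/(_ u uS); rewrite -memv_preim lfunE.
by move=> h; apply: (subvP SU); rewrite [h]idE; apply: subvsP.
Qed.

(** The span of the ordered monomials in the [x_i], [i] in [s], times [G]; the
    last index added is the leftmost one, as in the induced modules. *)
Fixpoint pbw_space (s : seq 'I_n) : {vspace H} :=
  if s is i :: s' then (\sum_(t < m i) (amull (x i ^+ t) @: pbw_space s'))%VS
  else <<codom gamma>>%VS.

Lemma pbw_space_cons i s t u : (t < m i)%N -> u \in pbw_space s ->
  x i ^+ t * u \in pbw_space (i :: s).
Proof.
move=> tm us; apply: (subvP (sumv_sup (Ordinal tm) _ (subvv _))) => //=.
by apply/memv_imgP; exists u; rewrite // lfunE.
Qed.

Lemma pbw_space_ind i s (U : {vspace H}) :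
  (forall t u, (t < m i)%N -> u \in pbw_space s -> x i ^+ t * u \in U) ->
  forall u, u \in pbw_space (i :: s) -> u \in U.
Proof.
move=> sU; apply/subvP/subv_sumP=> t _; apply/subvP=> _ /memv_imgP[u us ->].
by rewrite lfunE; apply: sU.
Qed.

Lemma gamma_pow_mul a i t :
  gamma a * x i ^+ t = ld_chi D i a ^+ t *: (x i ^+ t * gamma a).
Proof.
elim: t => [|t IH]; first by rewrite !expr0 mulr1 mul1r scale1r.
rewrite exprSr mulrA IH -scalerAl -[_ * gamma a * x i]mulrA (lr_gx relH).
by rewrite -scalerAr scalerA mulrA -!exprSr.
Qed.

(** A generator [x_j] is moved past the leftmost power of [x_i] by induction on
    the exponent of that power. *)
Lemma pbw_space_stable s : uniq s ->
  [/\ 1 \in pbw_space s, forall a u, u \in pbw_space s -> gamma a * u \in pbw_space s &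
      forall i u, i \in s -> u \in pbw_space s -> x i * u \in pbw_space s].
Proof.
elim: s => [_|i s IH /= /andP[i_s us]].
  split=> //=; first by rewrite -(lr_one relH) memv_span ?codom_f.
  move=> a u.
  have : (<<codom gamma>> <= amull (gamma a) @^-1: <<codom gamma>>)%VS.
    apply/span_subvP=> _ /codomP[b ->].
    by rewrite -memv_preim lfunE /= -(lr_mul relH) memv_span ?codom_f.
  by move/subvP=> h /h; rewrite -memv_preim lfunE.
have {IH}[s1 sg sx] := IH us.
have sub u : u \in pbw_space s -> u \in pbw_space (i :: s).
  by move=> uS; rewrite -[u]mul1r -(expr0 (x i)) pbw_space_cons // ld_m_gt0.
have gS a u : u \in pbw_space (i :: s) -> gamma a * u \in pbw_space (i :: s).
  suff : forall u, u \in pbw_space (i :: s) -> u \in (amull (gamma a) @^-1: pbw_space (i :: s))%VS.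
    by move=> h /h; rewrite -memv_preim lfunE.
  apply: pbw_space_ind => t v tm vs; rewrite -memv_preim lfunE /= mulrA.
  by rewrite gamma_pow_mul -scalerAl -mulrA memvZ // pbw_space_cons // sg.
have xS u : u \in pbw_space (i :: s) -> x i * u \in pbw_space (i :: s).
  suff : forall u, u \in pbw_space (i :: s) -> u \in (amull (x i) @^-1: pbw_space (i :: s))%VS.
    by move=> h /h; rewrite -memv_preim lfunE.
  apply: pbw_space_ind => t v; rewrite leq_eqVlt => /orP[/eqP tm|tm] vs;
    rewrite -memv_preim lfunE /= mulrA -exprS; last exact: pbw_space_cons.
  rewrite tm (lr_xm relH) -scalerAl memvZ // mulrBl mul1r memvB ?sub //.
  exact: sg.
split=> //; first exact: sub.
move=> j u; rewrite inE => /orP[/eqP ->|js]; first exact: xS.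
have ji : j != i by apply: contraNneq i_s => <-.
suff : forall u, u \in pbw_space (i :: s) -> u \in (amull (x j) @^-1: pbw_space (i :: s))%VS.
  by move=> h /h; rewrite -memv_preim lfunE.
apply: pbw_space_ind => t v tm vs; rewrite -memv_preim lfunE /=.
elim: t tm => [|t IHt] tm; first by rewrite expr0 mul1r sub // sx.
rewrite exprS !mulrA (lr_xx relH ji) !mulrDl -!scalerAl memvD ?memvZ //.
  by rewrite -!mulrA xS // IHt // ltnW.
have tS : x i ^+ t * v \in pbw_space (i :: s) by rewrite pbw_space_cons // ltnW.
by rewrite -mulrA mulrBl mul1r memvB // gS.
Qed.

Lemma pbw_space_mon s (U : {vspace H}) : uniq s ->
  (forall (r : 'I_n -> nat) a, (forall i, r i < m i)%N ->
    (\prod_(i <- s) x i ^+ r i) * gamma a \in U) ->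
  forall u, u \in pbw_space s -> u \in U.
Proof.
elim: s U => [|i s IH] U.
  move=> _ monU; apply/subvP/span_subvP=> _ /codomP[a ->].
  have := monU (fun=> 0%N) a; rewrite big_nil mul1r; apply=> i.
  exact: ld_m_gt0 axD i.
move=> /= /andP[i_s us] monU; apply: pbw_space_ind => t u tm.
have : forall u, u \in pbw_space s -> u \in (amull (x i ^+ t) @^-1: U)%VS.
  apply: IH => // r a rm; rewrite -memv_preim lfunE /=.
  have := monU (fun j => if j == i then t else r j) a.
  rewrite big_cons eqxx -mulrA; rewrite (eq_big_seq (fun j => x j ^+ r j)).
    by apply=> j; case: eqP => [->|].
  by move=> j js; case: eqP i_s => // <-; rewrite js.
by move=> h /h; rewrite -memv_preim lfunE.
Qed.

Definition pbw_index : finType := ({dffun forall i : 'I_n, 'I_(m i)} * G)%type.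

Definition pbw (b : pbw_index) : H := (\prod_i x i ^+ b.1 i) * gamma b.2.

Definition pbw_seq : seq H := [seq pbw b | b <- enum pbw_index].

Lemma card_pbw_index : #|pbw_index| = (#|G| * \prod_i m i)%N.
Proof.
rewrite card_prod mulnC; congr (_ * _)%N; rewrite card_dep_ffun foldrE big_map big_enum.
by apply: eq_bigr => i _; rewrite card_ord.
Qed.

(** The monomials span [H], and there are no more of them than the dimension. *)
Lemma pbw_basis : basis_of {:H} pbw_seq.
Proof.
rewrite basisEdim size_map -cardE card_pbw_index (lifting_dim_ge abelG axD presH) andbT.
have us := index_enum_uniq 'I_n.
apply/subvP=> u _; have [s1 sg sx] := pbw_space_stable us.
apply: (pbw_space_mon us) => [r a rm|]; last first.
  by apply: lifting_generated => // i v; apply: sx; rewrite mem_index_enum.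
apply: memv_span; apply/mapP; exists ([ffun i => Ordinal (rm i)], a).
  by rewrite mem_enum.
by congr (_ * _); apply: eq_bigr => i _; rewrite ffunE.
Qed.

(** Every basis monomial is obtained from 1 by right multiplications by
    generators. *)
Lemma lifting_ind (P : H -> Prop) :
  (forall c u v, P u -> P v -> P (c *: u + v)) -> P 1 ->
  (forall u a, P u -> P (u * gamma a)) -> (forall u i, P u -> P (u * x i)) ->
  forall u, P u.
Proof.
move=> Plin P1 Pg Px u.
have P0 : P 0 by have := Plin (-1) _ _ P1 P1; rewrite scaleN1r addNr.
have Pmon b : P (pbw b).
  have Pprod s v : P v -> P (v * \prod_(i <- s) x i ^+ b.1 i).
    elim: s v => [|i s IH] v Pv; first by rewrite big_nil mulr1.
    rewrite big_cons mulrA; apply: IH.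
    by elim: (b.1 i : nat) => [|t IHt]; rewrite ?mulr1 // exprSr mulrA; apply: Px.
  by apply: Pg; rewrite -[X in P X]mul1r; apply: Pprod.
have -> := coord_basis (pbw_basis : basis_of {:H} (in_tuple pbw_seq)) (memvf u).
apply: big_ind => // [v w Pv Pw|t _]; first by rewrite -[v]scale1r; apply: Plin.
rewrite -[_ *: _]addr0; apply: Plin => //.
by have /mapP[b _ ->] : pbw_seq`_t \in pbw_seq by rewrite mem_nth.
Qed.
End Spanning.

(** * Integrals *)

Section Slice.
Variables (k : fieldType) (H : falgType k).
Notation e := (vbasis {:H}).
Notation N := (\dim {:H}).

Lemma functionalZ (f : 'Hom(H, k^o)) c u : f (c *: u) = c * (f u : k).
Proof. exact: linearZ. Qed.

(** [slice f] is [f (x) id], with values in [k (x) H = H]. *)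
Definition slice (f : 'Hom(H, k^o)) (T : tensor H H) : H :=
  \sum_(i < N) \sum_(j < N) (T i j * (f e`_i : k)) *: e`_j.

Lemma slice_linear f : linear (slice f).
Proof.
move=> c T T'; rewrite /slice scaler_sumr -big_split; apply: eq_bigr => i _.
rewrite scaler_sumr -big_split; apply: eq_bigr => j _.
by rewrite !mxE mulrDl scalerDl scalerA mulrA.
Qed.
HB.instance Definition _ f := GRing.isSemilinear.Build k (tensor H H) H *:%R (slice f)
  (GRing.semilinear_linear (slice_linear f)).

Lemma slice_tens f u v : slice f (tens u v) = (f u : k) *: v.
Proof.
rewrite [v in RHS]coord_vbasisT [u in RHS]coord_vbasisT (linear_sum f) scaler_suml.
apply: eq_bigr => i _; rewrite scaler_sumr; apply: eq_bigr => j _.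
by rewrite mxE /= functionalZ scalerA mulrAC.
Qed.

Lemma slice_eval f h T : tens_eval f h T = h (slice f T).
Proof.
rewrite /slice linear_sum; apply: eq_bigr => i _.
rewrite linear_sum; apply: eq_bigr => j _.
by rewrite linearZ /= mulrA.
Qed.

Lemma slice_mull f u v T :
  slice f (tens u v * T) = v * slice (f \o amull u)%VF T.
Proof.
elim/(@tens_ind k H H): T => [u' v'|c s t IHs IHt].
  by rewrite [_ * _]tens_mulE !slice_tens comp_lfunE lfunE -scalerAr.
by rewrite mulrDr -scalerAr !linearP /= IHs IHt mulrDr scalerAr.
Qed.

Lemma slice_mulr f u v T :
  slice f (T * tens u v) = slice (f \o amulr u)%VF T * v.
Proof.
elim/(@tens_ind k H H): T => [u' v'|c s t IHs IHt].
  by rewrite [_ * _]tens_mulE !slice_tens comp_lfunE lfunE -scalerAl.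
by rewrite mulrDl -scalerAl !linearP /= IHs IHt mulrDl scalerAl.
Qed.

Lemma slice_lfun c (f f' : 'Hom(H, k^o)) T :
  slice (c *: f + f') T = c *: slice f T + slice f' T.
Proof.
elim/(@tens_ind k H H): T => [u v|d s t IHs IHt].
  rewrite !slice_tens add_lfunE scale_lfunE scalerDl scalerA.
  by rewrite [_ *: (_ : k^o)]/(_ * _).
rewrite !linearP /= IHs IHt; vring.
Qed.

Lemma slice_lfunZ c (f : 'Hom(H, k^o)) T : slice (c *: f) T = c *: slice f T.
Proof.
rewrite /slice scaler_sumr; apply: eq_bigr => i _.
rewrite scaler_sumr; apply: eq_bigr => j _.
by rewrite scale_lfunE scalerA mulrCA.
Qed.

Definition transpose (T : tensor H H) : tensor H H := (T : 'M_(N, N))^T.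
Lemma transpose_linear : linear transpose.
Proof. by move=> c T T'; apply/matrixP=> i j; rewrite !mxE. Qed.
HB.instance Definition _ := GRing.isSemilinear.Build k (tensor H H) (tensor H H) *:%R
  transpose (GRing.semilinear_linear transpose_linear).

Lemma transpose_tens u v : transpose (tens u v) = tens v u.
Proof. by apply/matrixP=> i j; rewrite !mxE mulrC. Qed.

Lemma transposeK : involutive transpose.
Proof. exact: trmxK. Qed.

(** The components of a tensor along the basis of the first factor. *)
Definition tens_row (T : tensor H H) i : H := \sum_(j < N) T i j *: e`_j.

HB.instance Definition _ (u : H) := GRing.isSemilinear.Build k H (tensor H H) *:%R
  (tens u) (GRing.semilinear_linear (@tens_linearr k H H u)).

Lemma tens_rowE T : T = \sum_(i < N) tens e`_i (tens_row T i).
Proof.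
rewrite [LHS]tens_coord; apply: eq_bigr => i _.
by rewrite /tens_row linear_sum; apply: eq_bigr => j _; rewrite linearZ.
Qed.

Lemma slice_transpose f T :
  slice f (transpose T) = \sum_(i < N) (f (tens_row T i) : k) *: e`_i.
Proof.
rewrite {1}[T]tens_rowE linear_sum linear_sum; apply: eq_bigr => i _.
by rewrite /= transpose_tens slice_tens.
Qed.

Variable Delta : 'AHom(H, tensor H H).

(** [psi(a_(1)) a_(2) = psi(a) 1]. *)
Definition dual_integral (psi : 'Hom(H, k^o)) :=
  forall a, slice psi (Delta a) = (psi a : k) *: 1.

Lemma dual_integralP psi : is_dual_right_integral Delta psi -> dual_integral psi.
Proof.
move=> psiP a; apply: vcoordP => i; rewrite vcoordZ.
have := psiP (linfun (coord e i : H -> k^o)) a.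
by rewrite /convolution slice_eval !lfunE /= mulrC.
Qed.

(** The canonical map [a (x) b |-> a b_(1) (x) b_(2)]. *)
Definition galois_map (T : tensor H H) : tensor H H :=
  \sum_(i < N) tens e`_i 1 * Delta (tens_row T i).

Lemma galois_map_linear : linear galois_map.
Proof.
move=> c T T'; rewrite /galois_map scaler_sumr -big_split; apply: eq_bigr => i _.
have -> : tens_row (c *: T + T') i = c *: tens_row T i + tens_row T' i.
  rewrite /tens_row scaler_sumr -big_split; apply: eq_bigr => j _.
  by rewrite !mxE scalerDl scalerA.
by rewrite linearP mulrDr -scalerAr.
Qed.
HB.instance Definition _ := GRing.isSemilinear.Build k (tensor H H) (tensor H H) *:%R
  galois_map (GRing.semilinear_linear galois_map_linear).

Lemma galois_map_tens u v : galois_map (tens u v) = tens u 1 * Delta v.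
Proof.
have -> : tens u 1 = \sum_(i < N) coord e i u *: tens e`_i 1 :> tensor H H.
  rewrite {1}[u]coord_vbasisT; apply/matrixP=> p q; rewrite !mxE !linear_sum.
  rewrite summxE mulr_suml; apply: eq_bigr => i _.
  by rewrite !mxE linearZ mulrA.
rewrite mulr_suml; apply: eq_bigr => i _.
have -> : tens_row (tens u v) i = coord e i u *: v.
  rewrite {2}[v]coord_vbasisT scaler_sumr; apply: eq_bigr => j _.
  by rewrite mxE scalerA.
by rewrite linearZ -scalerAl -scalerAr.
Qed.

Lemma galois_map_mul T h : galois_map (T * tens 1 h) = galois_map T * Delta h.
Proof.
elim/(@tens_ind k H H): T => [u v|c s t IHs IHt].
  by rewrite [_ * _]tens_mulE !galois_map_tens mulr1 rmorphM mulrA.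
by rewrite mulrDl -scalerAl !linearP /= IHs IHt mulrDl scalerAl.
Qed.
End Slice.

Section Integral.
Variables (k : fieldType) (G : finGroupType) (n : nat) (D : lifting_data k G n).
Hypotheses (abelG : abelian [set: G]) (axD : lifting_data_axioms D).
Variables (H : falgType k) (gamma : G -> H) (x : 'I_n -> H).
Hypothesis presH : is_lifting D gamma x.
Variable Delta : 'AHom(H, tensor H H).
Hypothesis DeltaP : is_lifting_comul D gamma x Delta.
Let relH : lifting_relations D gamma x := proj1 presH.
Let ind := lifting_ind abelG axD presH.
Notation e := (vbasis {:H}).
Notation N := (\dim {:H}).

Lemma gammaVl a : gamma a^-1%g * gamma a = 1.
Proof. by rewrite -(lr_mul relH) mulVg (lr_one relH). Qed.
Lemma gammaVr a : gamma a * gamma a^-1%g = 1.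
Proof. by rewrite -(lr_mul relH) mulgV (lr_one relH). Qed.

(** The image contains [H (x) 1] and is stable under right multiplication by
    [Delta(H)]. Since [u (x) v a = (u a^-1 (x) v) Delta(a)] for [a] in [G], and
    similarly for [x_i] up to a term with second factor [v], it is everything. So
    the map is bijective; it plays the part of the antipode below. *)
Lemma galois_map_bij : lker (linfun (@galois_map k H Delta)) = 0%VS.
Proof.
set B := linfun _; have BE T : B T = galois_map Delta T by rewrite lfunE.
have Bmul T h : T \in limg B -> T * Delta h \in limg B.
  case/memv_imgP=> S _ ->; apply/memv_imgP; exists (S * tens 1 h); rewrite ?memvf //.
  by rewrite !BE galois_map_mul.
have [Dg Dx] := DeltaP.
have tensB v : forall u, tens u v \in limg B.
  elim/ind: v => [c v w IHv IHw u||v a IH u|v i IH u].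
  - by rewrite linearP /= memvD ?memvZ ?IHv ?IHw.
  - move=> u; apply/memv_imgP; exists (tens u 1); rewrite ?memvf // BE galois_map_tens.
    by rewrite rmorph1 mulr1.
  - have := Bmul _ (gamma a) (IH (u * gamma a^-1%g)).
    by rewrite Dg [_ * _]tens_mulE -mulrA gammaVl mulr1.
  set g := ld_g D i; have := Bmul _ (x i) (IH (u * gamma g^-1%g)).
  rewrite Dx mulrDr ![tens _ _ * _]tens_mulE -(mulrA u) gammaVl !mulr1.
  move=> uvx; rewrite -[tens u _](addrK (tens (u * gamma g^-1%g * x i) v)).
  by rewrite memvB.
apply/eqP; rewrite -dimv_eq0.
have := limg_ker_dim B fullv; rewrite capfv => dimB.
suff full : limg B = fullv.
  by move: dimB; rewrite full -[RHS]add0n => /addIn ->.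
apply/eqP; rewrite eqEsubv subvf; apply/subvP=> T _.
by rewrite [T]tens_coord memv_suml // => i _; rewrite memv_suml // => j _; rewrite memvZ.
Qed.

Section Radical.
Variable psi : 'Hom(H, k^o).
Hypothesis psiP : dual_integral Delta psi.
Notation radical b := (forall a : H, psi (a * b) = 0).

Lemma slice_amull_lin c u v T : slice (psi \o amull (c *: u + v)) T =
  c *: slice (psi \o amull u) T + slice (psi \o amull v) T.
Proof.
rewrite -slice_lfun; congr (slice _ _); apply/lfunP=> h.
rewrite add_lfunE scale_lfunE !comp_lfunE !lfunE /= mulrDl -scalerAl.
exact: linearP.
Qed.

Lemma slice_amull_mul u v T : slice ((psi \o amull u) \o amull v) T =
  slice (psi \o amull (u * v)) T.
Proof.
congr (slice _ _); apply/lfunP=> h; rewrite !comp_lfunE !lfunE /=.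
by rewrite mulrA.
Qed.

(** The radical [R] of the form [psi(a b)] is a right coideal: [Delta] maps it to
    [R (x) H], which is the common kernel of the slices by the [psi(a -)]. For
    [a = 1] this is the integral property; the case of [u y], [y] a generator,
    follows from the case of [u] applied to [y b], again in [R]. *)
Lemma radical_coideal a b : radical b -> slice (psi \o amull a) (Delta b) = 0.
Proof.
have [Dg Dx] := DeltaP.
have radM b' h : radical b' -> radical (h * b').
  by move=> rb a'; rewrite mulrA.
have gstep u c : (forall b, radical b -> slice (psi \o amull u) (Delta b) = 0) ->
    forall b, radical b -> slice (psi \o amull (u * gamma c)) (Delta b) = 0.
  move=> IH b' rb; have := IH _ (radM _ (gamma c) rb).
  rewrite rmorphM /= Dg slice_mull slice_amull_mul => /(congr1 ( *%R (gamma c^-1%g))).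
  by rewrite mulrA gammaVl mul1r mulr0.
elim/ind: a b => [c u v IHu IHv b rb||u a IH b rb|u i IH b rb].
- by rewrite slice_amull_lin IHu // IHv // scaler0 addr0.
- move=> b rb; have -> : (psi \o amull 1)%VF = psi.
    by apply/lfunP=> h; rewrite comp_lfunE lfunE /= mul1r.
  by rewrite psiP -[b]mul1r rb scale0r.
- exact: gstep.
have := IH _ (radM _ (x i) rb); rewrite rmorphM /= Dx mulrDl linearD /=.
by rewrite !slice_mull !slice_amull_mul gstep // mulr0 add0r mul1r.
Qed.

(** The canonical map sends [H (x) R] into [R (x) H]. As it is injective and these
    spaces have the same dimension, [R (x) H] is the image of [H (x) R]. Now
    [b (x) 1], in [R (x) H], is its own image, hence lies in [H (x) R]; if
    [b <> 0] then 1 is in [R], that is [psi = 0]. *)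
Lemma integral_nondegenerate b : radical b -> b != 0 -> psi = 0.
Proof.
move=> rb b0; apply/lfunP=> a; rewrite zero_lfunE.
(* U1 is R (x) H, and tau @: U1 is H (x) R. *)
pose U1 := (\bigcap_(i < N) lker (linfun (slice (psi \o amull e`_i))))%VS.
have U1P T : reflect (forall c, slice (psi \o amull c) T = 0) (T \in U1).
  apply: (iffP idP) => [/subv_bigcapP TU c|TU]; last first.
    by apply/subv_bigcapP=> i _; rewrite -memvE memv_ker lfunE /= TU.
  have lin : linear (fun d => slice (psi \o amull d) T).
    by move=> d u v; apply: slice_amull_lin.
  pose L : {linear H -> H} := HB.pack (fun d => slice (psi \o amull d) T)
    (GRing.isSemilinear.Build k H H *:%R _ (GRing.semilinear_linear lin)).
  rewrite -[LHS]/(L c) [c]coord_vbasisT linear_sum big1 // => i _.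
  rewrite linearZ /=; have := TU i isT; rewrite -memvE memv_ker lfunE /= => /eqP ->.
  exact: scaler0.
pose B := linfun (galois_map Delta); pose tau := linfun (@transpose k H).
have tau_inj : lker tau = 0%VS.
  by apply/eqP/lker0P=> S T; rewrite !lfunE /=; apply: inv_inj (@transposeK k H) _ _.
have BU : (B @: (tau @: U1) = U1)%VS.
  apply/eqP; rewrite eqEdim limg_dim_eq ?galois_map_bij ?capv0 //.
  rewrite limg_dim_eq ?tau_inj ?capv0 // leqnn andbT.
  apply/subvP=> _ /memv_imgP[_ /memv_imgP[T /U1P TU ->] ->].
  apply/U1P=> c; rewrite !lfunE /= /galois_map linear_sum big1 // => i _ /=.
  rewrite slice_mull slice_amull_mul mul1r radical_coideal // => d.
  have := TU d; rewrite -[T in slice _ T]transposeK slice_transpose => T0.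
  have := congr1 (coord e i) T0.
  rewrite linear0 coord_sum_free ?(basis_free (vbasisP _)) //.
  by rewrite comp_lfunE lfunE.
have bU : tens b 1 \in U1.
  apply/U1P=> c; rewrite slice_tens comp_lfunE lfunE /= rb; exact: scale0r.
have : tens b 1 \in (B @: (tau @: U1))%VS by rewrite BU.
case/memv_imgP=> S /memv_imgP[T /U1P TU ->] Sb.
have TE : tau T = tens b 1.
  apply/(lker0P (introT eqP galois_map_bij)); rewrite -/B -Sb.
  by rewrite lfunE /= galois_map_tens rmorph1 mulr1.
have := TU a; have -> : T = tens 1 b.
  by rewrite -[T]transposeK -[transpose T](lfunE (@transpose k H)) TE transpose_tens.
rewrite slice_tens comp_lfunE lfunE /= mulr1 => /eqP.
by rewrite scaler_eq0 (negPf b0) orbF => /eqP.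
Qed.
End Radical.
End Integral.

(** * The Nakayama automorphism on the basis *)

Section Nakayama.
Variables (k : fieldType) (G : finGroupType) (n : nat) (D : lifting_data k G n).
Hypotheses (abelG : abelian [set: G]) (axD : lifting_data_axioms D).
Variables (H : falgType k) (gamma : G -> H) (x : 'I_n -> H).
Hypothesis presH : is_lifting D gamma x.
Variable Delta : 'AHom(H, tensor H H).
Hypothesis DeltaP : is_lifting_comul D gamma x Delta.
Variable eps : 'AHom(H, k^o).
Hypothesis epsP : is_lifting_counit gamma x eps.
Variable phi : 'Hom(H, k^o).
Hypotheses (phi_neq0 : phi != 0) (phiP : dual_integral Delta phi).
Variable rho : 'AEnd(H).
Hypothesis rhoP : is_nakayama phi rho.
Variable alpha : 'AHom(H, k^o).
Hypothesis alphaP : is_modular_element eps alpha.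
Let relH : lifting_relations D gamma x := proj1 presH.

Lemma lfun_unit (f : 'AHom(H, k^o)) a : (f (gamma a) : k) * f (gamma a^-1%g) = 1.
Proof. by rewrite -[LHS](rmorphM f) (gammaVr presH) rmorph1. Qed.

Lemma alpha_gamma_neq0 a : (alpha (gamma a) : k) != 0.
Proof.
apply/eqP=> a0; have /eqP := lfun_unit alpha a.
by rewrite a0 mul0r eq_sym oner_eq0.
Qed.

Lemma alpha_gammaV a : alpha (gamma a^-1%g) = (alpha (gamma a))^-1 :> k.
Proof. by apply: (mulfI (alpha_gamma_neq0 a)); rewrite lfun_unit divff ?alpha_gamma_neq0. Qed.

Lemma alpha_x i : alpha (x i) = 0 :> k.
Proof.
have := congr1 alpha (lr_gx relH (ld_g D i) i).
rewrite linearZ /= !rmorphM /= [X in _ = _ *: X]mulrC.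
move/eqP; rewrite -subr_eq0 -{1}[_ * _]mul1r.
rewrite -[_ *: _]/(ld_chi D i (ld_g D i) * _) -mulrBl !mulf_eq0 subr_eq0.
rewrite eq_sym (negPf (ld_qii axD i)) (negPf (alpha_gamma_neq0 _)) /=.
by move/eqP.
Qed.

(** [psi] vanishes on the left ideal [H t = k t], so that [t] is in its radical.
    Applied to a difference this is the uniqueness of integrals. *)
Lemma integral_eq0 psi t : dual_integral Delta psi -> t != 0 ->
  (forall h, h * t = (alpha h : k) *: t) -> psi t = 0 -> psi = 0.
Proof.
move=> psiI t0 tP psit; apply: (integral_nondegenerate abelG axD presH DeltaP psiI _ t0).
by move=> a; rewrite tP functionalZ psit mulr0.
Qed.

Lemma dual_integral_lin c psi psi' : dual_integral Delta psi ->
  dual_integral Delta psi' -> dual_integral Delta (c *: psi + psi').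
Proof.
by move=> I1 I2 a; rewrite slice_lfun I1 I2 add_lfunE scale_lfunE scalerDl scalerA.
Qed.

(** Conjugation by [g] preserves the comultiplication, hence maps [phi] to another
    integral; evaluating both at [t] gives the factor. *)
Lemma integral_conj a g : phi (gamma g^-1%g * a * gamma g) = (alpha (gamma g^-1%g) : k) * phi a.
Proof.
have [t [t0 tr tl]] := alphaP; have [eg ex] := epsP; have [Dg Dx] := DeltaP.
have phit : phi t != 0 by apply: contra_neq phi_neq0 => /(integral_eq0 phiP t0 tl).
pose psi := ((phi \o amull (gamma g^-1%g)) \o amulr (gamma g))%VF.
have psiE h : psi h = phi (gamma g^-1%g * h * gamma g).
  by rewrite !comp_lfunE !lfunE /= mulrA.
have psiI : dual_integral Delta psi.
  move=> h; have := phiP (gamma g^-1%g * h * gamma g).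
  rewrite !rmorphM /= !Dg slice_mulr slice_mull psiE.
  have -> : slice ((phi \o amulr (gamma g)) \o amull (gamma g^-1%g)) (Delta h) = slice psi (Delta h).
    congr (slice _ _); apply/lfunP=> h'; rewrite psiE !comp_lfunE !lfunE /=.
    by [].
  move/(congr1 (fun z => gamma g * z * gamma g^-1%g)).
  rewrite mulrA mulrA (gammaVr presH) mul1r -mulrA (gammaVr presH) mulr1 => ->.
  by rewrite -scalerAr mulr1 -scalerAl (gammaVr presH).
pose c : k := alpha (gamma g^-1%g).
suff /lfunP/(_ a) : (- c) *: phi + psi = 0.
  rewrite add_lfunE scale_lfunE zero_lfunE psiE => /eqP; rewrite addrC scaleNr subr_eq0.
  by move/eqP.
apply: (integral_eq0 (dual_integral_lin _ phiP psiI) t0 tl).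
rewrite add_lfunE scale_lfunE psiE tl -scalerAl tr eg !functionalZ mul1r.
by rewrite scaleNr; exact: addNr.
Qed.

Lemma integral_gamma a g : phi (a * gamma g) = (alpha (gamma g^-1%g) : k) * phi (gamma g * a).
Proof. by rewrite -integral_conj mulrA (gammaVl presH) mul1r. Qed.

(** The functional [psi(a) = phi(a x_i) - d phi(x_i a)] is an integral for this
    value of [d], and it vanishes at [t] since [eps(x_i) = alpha(x_i) = 0]. *)
Lemma integral_x a i : phi (a * x i) =
  (alpha (gamma (ld_g D i)^-1%g) : k) * (ld_q D i i)^-1 * phi (x i * a).
Proof.
have [t [t0 tr tl]] := alphaP; have [eg ex] := epsP; have [Dg Dx] := DeltaP.
set g := ld_g D i; set al : k := alpha _; set q := ld_q D i i.
pose d := al * q^-1; pose psi := (- d *: (phi \o amull (x i)) + (phi \o amulr (x i)))%VF.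
have psiE h : psi h = phi (h * x i) - d * phi (x i * h).
  rewrite add_lfunE scale_lfunE !comp_lfunE !lfunE /= scaleNr; exact: addrC.
have qV : gamma g^-1%g * x i = q^-1 *: (x i * gamma g^-1%g).
  by rewrite (lr_gx relH) (charV (ld_char axD i)).
have sg h : slice (phi \o amull (gamma g)) (Delta h) = (phi (gamma g * h) : k) *: gamma g^-1%g.
  have := phiP (gamma g * h); rewrite rmorphM /= Dg slice_mull.
  move/(congr1 ( *%R (gamma g^-1%g))); rewrite mulrA (gammaVl presH) mul1r => ->.
  by rewrite -scalerAr mulr1.
have sx h : slice (phi \o amull (x i)) (Delta h) =
    (phi (x i * h) : k) *: 1 - (phi (gamma g * h) : k) *: (x i * gamma g^-1%g).
  have := phiP (x i * h); rewrite rmorphM /= Dx mulrDl linearD /= !slice_mull sg.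
  by move=> <-; rewrite mul1r -scalerAr [X in X - _]addrC addrK.
have sgr h : slice (phi \o amulr (gamma g)) (Delta h) =
    (al * phi (gamma g * h)) *: gamma g^-1%g.
  rewrite -scalerA -sg -slice_lfunZ; congr (slice _ _); apply/lfunP=> h'.
  rewrite scale_lfunE !comp_lfunE !lfunE /=; exact: integral_gamma.
have sxr h : slice (phi \o amulr (x i)) (Delta h) =
    (phi (h * x i) : k) *: 1 - (al * phi (gamma g * h)) *: (gamma g^-1%g * x i).
  have := phiP (h * x i); rewrite rmorphM /= Dx mulrDr linearD /= !slice_mulr sgr.
  by move=> <-; rewrite mulr1 -scalerAl [X in X - _]addrC addrK.
have psiI : dual_integral Delta psi.
  by move=> h; rewrite slice_lfun sx sxr psiE qV /d; vring.
suff psi0 : psi = 0.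
  by apply/eqP; rewrite -subr_eq0 -psiE psi0 zero_lfunE.
apply: (integral_eq0 psiI t0 tl).
rewrite psiE tl tr ex alpha_x !scale0r !linear0 mulr0; exact: subrr.
Qed.

(** The form is nondegenerate on the left too, because [rho] is bijective. *)
Lemma rho_eq h c : (forall a, phi (a * h) = c * (phi (h * a) : k)) -> rho h = c *: h.
Proof.
move=> hP; have [rho_bij rhoE] := rhoP.
apply/eqP; rewrite -subr_eq0; set z := _ - _.
have z0 a : phi (z * a) = 0.
  rewrite mulrBl linearB /= -rhoE hP -scalerAl linearZ /=; exact: subrr.
have [rho' rhoK rho'K] := rho_bij.
have : rho' z == 0.
  apply: contraNT phi_neq0 => z'0; apply/eqP.
  apply: (integral_nondegenerate abelG axD presH DeltaP phiP _ z'0) => a.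
  by rewrite rhoE rho'K z0.
by move/eqP/(congr1 rho); rewrite rho'K linear0 => ->.
Qed.

Lemma rho_gamma a : rho (gamma a) = (alpha (gamma a) : k)^-1 *: gamma a.
Proof. by apply: rho_eq => h; rewrite integral_gamma alpha_gammaV. Qed.

Lemma rho_x i :
  rho (x i) = ((alpha (gamma (ld_g D i)) : k)^-1 * (ld_q D i i)^-1) *: x i.
Proof. by apply: rho_eq => h; rewrite integral_x alpha_gammaV. Qed.

(** The eigenvalue of [rho] on a basis monomial. *)
Definition pbw_weight (b : pbw_index D) : k :=
  (\prod_i ((alpha (gamma (ld_g D i)) : k)^-1 * (ld_q D i i)^-1) ^+ b.1 i)
  * (alpha (gamma b.2))^-1.

Lemma rho_pbw b : rho (pbw gamma x b) = pbw_weight b *: pbw gamma x b.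
Proof.
rewrite /pbw /pbw_weight rmorphM /= rho_gamma rmorph_prod.
rewrite -scalerAr mulrC -scalerA; congr (_ *: _).
rewrite [RHS]scalerAl; congr (_ * _).
elim/big_rec3: _ => [|i u v w _ ->]; first by rewrite scale1r.
by rewrite rmorphXn /= rho_x exprZn -scalerAl -scalerAr scalerA.
Qed.
End Nakayama.

(** * Eigenspaces and the counting of weights *)

Section Diagonal.
Variables (k : fieldType) (V : vectType k) (B : finType) (v : B -> V) (c : B -> k).
Hypothesis v_basis : basis_of {:V} [seq v b | b <- enum B].
Variable f : 'End(V).
Hypothesis f_v : forall b, f (v b) = c b *: v b.

Definition multiplicity (w : k) := #|[set b | c b == w]|.

Lemma leigenspaceP (w : k) u :
  reflect (f u = w *: u) (u \in passmx.leigenspace f w).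
Proof.
rewrite memv_ker add_lfunE opp_lfunE scale_lfunE id_lfunE subr_eq0.
exact: eqP.
Qed.

Lemma leigenspace_diagonal w :
  passmx.leigenspace f w = <<[seq v b | b <- enum [set b | c b == w]]>>%VS.
Proof.
apply/eqP; rewrite eqEsubv andbC; apply/andP; split.
  apply/span_subvP=> y /mapP[b]; rewrite mem_enum inE => /eqP cb ->.
  by apply/leigenspaceP; rewrite f_v cb.
apply/subvP=> u /leigenspaceP fu.
pose X := in_tuple [seq v b | b <- enum B].
have XE (t : 'I_(size [seq v b | b <- enum B])) :
    exists b, X`_t = v b.
  have /mapP[b _ Xb] : X`_t \in [seq v b | b <- enum B] by rewrite mem_nth.
  by exists b.
have uE : u = \sum_t coord X t u *: X`_t := coord_basis (v_basis : basis_of {:V} X) (memvf u).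
have [cX cXE] : exists cX : 'I_(size [seq v b | b <- enum B]) -> k,
    forall t : 'I_(size [seq v b | b <- enum B]), exists2 b, X`_t = v b & cX t = c b.
  have /fin_all_exists[bX bXE] := XE.
  by exists (fun t => c (bX t)) => t; exists (bX t).
have fX (t : 'I_(size [seq v b | b <- enum B])) : f X`_t = cX t *: X`_t by have [b -> ->] := cXE t.
have coords t : coord X t u * cX t = w * coord X t u.
  have freeX : free X := basis_free v_basis.
  have <- : coord X t (f u) = coord X t u * cX t.
    rewrite {1}uE linear_sum (eq_bigr (fun r => (coord X r u * cX r) *: X`_r)).
      by rewrite coord_sum_free.
    by move=> r _; rewrite linearZ /= fX scalerA.
  by rewrite fu linearZ.
rewrite uE memv_suml // => t _; have [b Xb cb] := cXE t.
have [->|ct] := eqVneq (coord X t u) 0; first by rewrite scale0r mem0v.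
rewrite memvZ // Xb memv_span // map_f // mem_enum inE -cb.
by have := coords t; rewrite mulrC => /(mulIf ct) ->.
Qed.

Lemma dim_leigenspace_diagonal w : \dim (passmx.leigenspace f w) = multiplicity w.
Proof.
rewrite leigenspace_diagonal /multiplicity cardE.
set s := enum _; rewrite -(size_map v s); apply/eqP; rewrite -/(free _).
have : free [seq v b | b <- s ++ [seq b <- enum B | c b != w]].
  rewrite (perm_free (Y := [seq v b | b <- enum B])) ?(basis_free v_basis) //.
  have -> : s = [seq b <- enum B | c b == w].
    by rewrite enumT /s /enum_mem; apply: eq_filter => b; apply: in_set.
  by apply: perm_map; rewrite perm_filterC.
by rewrite map_cat => /catl_free.
Qed.

Lemma sum_leigenspace_diagonal (s : seq k) : (forall b, c b \in s) ->
  (\sum_(w <- s) passmx.leigenspace f w)%VS = fullv.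
Proof.
move=> cs; apply/eqP; rewrite eqEsubv subvf -(span_basis v_basis).
apply/span_subvP=> _ /mapP[b _ ->].
rewrite (big_rem _ (cs b)) /=; apply: (subvP (addvSl _ _)).
exact/leigenspaceP.
Qed.

Lemma sum_multiplicity (s : seq k) : uniq s -> (forall b, c b \in s) ->
  (\sum_(w <- s) multiplicity w)%N = #|B|.
Proof.
move=> us cs; rewrite -sum1_card.
transitivity (\sum_(w <- s) \sum_(b : B) (c b == w))%N.
  apply: eq_bigr => w _; rewrite /multiplicity -sum1_card big_mkcond /=.
  by apply: eq_bigr => b _; rewrite inE; case: eqP.
rewrite exchange_big; apply: eq_bigr => b _.
rewrite (bigD1_seq (c b)) //= eqxx big1 // => w.
by rewrite eq_sym => /negPf ->.
Qed.

Lemma directv_leigenspace_diagonal (s : seq k) : uniq s -> (forall b, c b \in s) ->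
  directv (\sum_(w <- s) passmx.leigenspace f w).
Proof.
move=> us cs; rewrite directvE /= sum_leigenspace_diagonal //.
rewrite (eq_bigr multiplicity) => [|w _]; last exact: dim_leigenspace_diagonal.
by rewrite sum_multiplicity // (size_basis v_basis).
Qed.
End Diagonal.

Lemma multiplicity_shift (k : fieldType) (B : finType) (c : B -> k) (w : k) (tau : B -> B) :
  w != 0 -> injective tau -> (forall b, c (tau b) = w * c b) ->
  forall v, multiplicity c (w * v) = multiplicity c v.
Proof.
move=> w0 tau_inj ctau v; rewrite /multiplicity -[RHS](card_imset _ tau_inj).
congr #|pred_of_set _|; apply/setP=> b; rewrite inE; apply/eqP/imsetP => [cb|[b' + ->]].
  have [g gK Kg] := injF_bij tau_inj; exists (g b); rewrite ?Kg // inE.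
  by apply/eqP/(mulfI w0); rewrite -ctau Kg.
by rewrite inE ctau => /eqP ->.
Qed.

Section Weights.
Variables (k : fieldType) (G : finGroupType) (n : nat) (D : lifting_data k G n).
Hypotheses (axD : lifting_data_axioms D).
Variables (H : falgType k) (gamma : G -> H) (x : 'I_n -> H).
Hypothesis presH : is_lifting D gamma x.
Variable alpha : 'AHom(H, k^o).
Notation m := (ld_m D).
Notation B := (pbw_index D).
Notation wt := (pbw_weight gamma alpha).
Notation A a := (alpha (gamma a) : k).

Lemma alpha_gammaM a b : A (a * b)%g = A a * A b.
Proof. by rewrite (lr_mul (proj1 presH)) rmorphM. Qed.

Definition shift_group (a : G) (b : B) : B := (b.1, (b.2 * a^-1)%g).

Lemma shift_group_inj a : injective (shift_group a).
Proof. by move=> [r g] [r' g'] [-> /mulIg ->]. Qed.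

Lemma wt_shift_group a b : wt (shift_group a b) = A a * wt b.
Proof.
rewrite /pbw_weight /= alpha_gammaM (alpha_gammaV presH) invfM invrK.
by rewrite mulrA mulrC.
Qed.

(** Raise the exponent [r_i] cyclically modulo [m_i], and correct the group
    component so that the power of [alpha(g_i)] in the weight does not change. *)
Definition shift_root (i : 'I_n) (b : B) : B :=
  ([ffun j => dfwith (fun j => b.1 j) (ordS (b.1 i)) j],
   (b.2 * (if ((b.1 i).+1 < m i)%N then (ld_g D i)^-1
           else ld_g D i ^+ (m i).-1))%g).

Lemma shift_root_inj i : injective (shift_root i).
Proof.
move=> [r g] [r' g'] /pair_equal_spec /= [/ffunP rr' gg'].
have rr : r = r'.
  apply/ffunP=> j; have := rr' j; rewrite !ffunE.
  have [->|ij] := eqVneq j i; last by rewrite !dfwith_out // eq_sym.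
  by rewrite !dfwith_in; apply: (bij_inj (@ordS_bij _)).
by move: gg'; rewrite rr => /mulIg ->.
Qed.

(** At the wrap-around the weight loses [q_ii^-(m_i - 1)], which is again
    multiplication by [q_ii^-1]. *)
Lemma wt_shift_root i b : wt (shift_root i b) = (ld_q D i i)^-1 * wt b.
Proof.
rewrite /pbw_weight /= alpha_gammaM !(bigD1 i (P := xpredT)) //= ffunE dfwith_in /=.
rewrite [X in _ * X * _](eq_bigr (fun j => ((A (ld_g D j))^-1 * (ld_q D j j)^-1) ^+ b.1 j)).
  set P := \prod_(j | _) _; set a := A (ld_g D i); set q := ld_q D i i.
  have a0 : a != 0 := alpha_gamma_neq0 presH alpha _.
  have q0 : q != 0 := char_neq0 (ld_char axD i) _.
  have g0 : A b.2 != 0 := alpha_gamma_neq0 presH alpha _.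
  case: ifP => [rm|/negbT rm].
    rewrite modn_small // (alpha_gammaV presH) -/a exprS.
    by field; rewrite a0 q0 g0.
  have rE : (b.1 i).+1 = m i.
    by apply/eqP; rewrite eqn_leq ltn_ord leqNgt.
  rewrite rE modnn expr0 mul1r.
  have -> : (m i).-1 = b.1 i by exact: (esym (congr1 predn rE)).
  have -> : A (ld_g D i ^+ b.1 i)%g = a ^+ b.1 i.
    elim: (b.1 i : nat) => [|t IH]; last by rewrite expgS alpha_gammaM IH exprS.
    by rewrite expg0 (lr_one (proj1 presH)) rmorph1.
  have : q ^+ (b.1 i).+1 = 1 by rewrite rE; apply: prim_expr_order (ld_order axD i).
  rewrite exprS => qr.
  have qrE : q ^+ b.1 i = q^-1 by apply: (mulfI q0); rewrite qr divff.
  rewrite exprMn !exprVn qrE invrK.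
  have ar0 : a ^+ b.1 i != 0 by rewrite expf_neq0.
  by field; rewrite q0 g0 ar0.
by move=> j ij; rewrite ffunE dfwith_out // eq_sym.
Qed.
End Weights.

Section Equidimensional.
Variables (k : fieldType) (G : finGroupType) (n : nat) (D : lifting_data k G n).
Hypotheses (axD : lifting_data_axioms D).
Variables (H : falgType k) (gamma : G -> H) (x : 'I_n -> H).
Hypothesis presH : is_lifting D gamma x.
Variable alpha : 'AHom(H, k^o).
Notation m := (ld_m D).
Notation B := (pbw_index D).
Notation wt := (@pbw_weight k G n D H gamma alpha).
Notation A a := (alpha (gamma a) : k).
Notation L := (L1 D gamma alpha).

Lemma q_neq0 i : ld_q D i i != 0.
Proof. exact: char_neq0 (ld_char axD i) _. Qed.

(** The scalars [w] such that multiplication by [w] preserves all the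
    multiplicities form a group, and it contains the generators of [L1]. *)
Lemma multiplicity_L1 w : L w ->
  w != 0 /\ forall v, multiplicity wt (w * v) = multiplicity wt v.
Proof.
elim=> [{}w [[i ->]|[a ->]]||{}w w' _ [w0 IH] _ [w'0 IH']|{}w _ [w0 IH]].
- split=> [|v]; first exact: q_neq0.
  rewrite -(multiplicity_shift _ (@shift_root_inj k G n D i)
    (wt_shift_root axD presH alpha i)) ?invr_eq0 ?q_neq0 //.
  by rewrite mulKf ?q_neq0.
- split=> [|v]; first exact: alpha_gamma_neq0 presH alpha a.
  apply: (multiplicity_shift _ (@shift_group_inj k G n D a) (wt_shift_group presH alpha a)).
  exact: alpha_gamma_neq0 presH alpha a.
- by split=> [|v]; rewrite ?oner_neq0 ?mul1r.
- by split=> [|v]; rewrite ?mulf_neq0 // -mulrA IH IH'.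
- split=> [|v]; first by rewrite invr_eq0.
  by rewrite -IH mulVKf.
Qed.

Lemma weight_L1 b : L (wt b).
Proof.
have LM w w' : L w -> L w' -> L (w * w') by apply: gen_mul.
have LV w : L w -> L w^-1 by apply: gen_inv.
have LA a : L (A a) by apply: gen_mem; right; exists a.
have Lq i : L (ld_q D i i) by apply: gen_mem; left; exists i.
have L1' : L 1 by apply: gen_one.
rewrite /pbw_weight; apply: (LM); last exact: LV.
apply: (big_ind (fun w => L w) L1' LM) => i _.
elim: (b.1 i : nat) => [|t IH]; first by rewrite expr0.
by rewrite exprS; apply: (LM) IH; apply: (LM); apply: (LV).
Qed.

Lemma multiplicity1_gt0 : (0 < multiplicity wt 1)%N.
Proof.
apply/card_gt0P; exists ([ffun i => Ordinal (ld_m_gt0 axD i)], 1%g).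
rewrite inE /pbw_weight /= (lr_one (proj1 presH)) rmorph1 invr1 mulr1.
by rewrite big1 // => i _; rewrite ffunE expr0.
Qed.
End Equidimensional.

Theorem mainTheorem4 (k : fieldType) (G : finGroupType)
    (abelG : abelian [set: G]) (n : nat)
    (D : lifting_data k G n) (axD : lifting_data_axioms D)
    (H : falgType k) (gamma : G -> H) (x : 'I_n -> H)
    (presH : is_lifting D gamma x)
    (Delta : 'AHom(H, tensor H H)) (DeltaP : is_lifting_comul D gamma x Delta)
    (eps : 'AHom(H, k^o)) (epsP : is_lifting_counit gamma x eps)
    (phi : 'Hom(H, k^o)) (phi_neq0 : phi != 0)
    (phiP : is_dual_right_integral Delta phi)
    (rho : 'AEnd(H)) (rhoP : is_nakayama phi rho)
    (alpha : 'AHom(H, k^o)) (alphaP : is_modular_element eps alpha) :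
  (exists s : seq k,
     [/\ uniq s,
         forall w : k, w \in s <-> L1 D gamma alpha w,
         (\sum_(w <- s) passmx.leigenspace rho w)%VS = fullv
       & directv (\sum_(w <- s) passmx.leigenspace rho w)]) /\
  (forall w w' : k, L1 D gamma alpha w -> L1 D gamma alpha w' ->
     \dim (passmx.leigenspace rho w) = \dim (passmx.leigenspace rho w')).

Proof.
have phiI := dual_integralP phiP.
have basisE := pbw_basis abelG axD presH.
have rhoE (b : pbw_index D) : rho (pbw gamma x b) = pbw_weight gamma alpha b *: pbw gamma x b.
  exact: (rho_pbw abelG axD presH DeltaP epsP phi_neq0 phiI rhoP alphaP).
have dimE w : L1 D gamma alpha w ->
    \dim (passmx.leigenspace rho w) = multiplicity (@pbw_weight k G n D H gamma alpha) 1.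
  move=> Lw; rewrite (dim_leigenspace_diagonal basisE rhoE).
  by rewrite -[w in LHS]mulr1 (multiplicity_L1 axD presH Lw).2.
split=> [|w w' Lw Lw']; last by rewrite !dimE.
pose s := undup [seq @pbw_weight k G n D H gamma alpha b | b <- enum (pbw_index D)].
have us : uniq s := undup_uniq _.
have cs (b : pbw_index D) : pbw_weight gamma alpha b \in s.
  by rewrite mem_undup map_f // mem_enum.
exists s; split=> // [w||].
- split=> [|Lw]; first by rewrite mem_undup => /mapP[b _ ->]; apply: weight_L1.
  have := multiplicity1_gt0 axD presH alpha.
  rewrite -(multiplicity_L1 axD presH Lw).2 mulr1 => /card_gt0P[b].
  by rewrite inE => /eqP <-.
- exact: (sum_leigenspace_diagonal basisE rhoE cs).
- exact: (directv_leigenspace_diagonal basisE rhoE us cs).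
Qed.
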